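(* All proper $KG$-submodules of $L$ are contained in $L(1)$; that is, $\mathrm{rad}(L)=L(1)$.
   Context: Let $n\ge 2$ and $G=\mathrm{GL}_n(q)$, the general linear group over the finite field $F_q$ of characteristic $p$. Let $\ell\ne p$ be a prime, and let $R$ be a local principal ideal domain of characteristic $0$ with maximal ideal $\ell R$, containing a primitive $p$-th root of unity; $K=R/\ell R$. Modules are left modules. $B$ is the group of upper triangular matrices in $G$; $S_n$ is viewed as the subgroup of permutation matrices of $G$; $\widehat{S}=\sum_{s\in S}s\in RG$ for $S\subseteq G$. Put $\varepsilon=\sum_{\sigma\in S_n}\mathrm{sg}(\sigma)\,\sigma\widehat{B}\in RG$. The Steinberg lattice is the left ideal $I=RG\cdot\varepsilon$, and $L=I/\ell I$, a $KG$-module. Let $f:I\times I\to R$ be the restriction to $I$ of the $R$-bilinear form on $RG$ given by $(g,h)\mapsto\delta_{g,h}$ for $g,h\in G$, scaled by $1/|B|$ (it takes values in $R$). For $c\ge 0$ put $I(c)=\{x\in I : f(x,I)\subseteq \ell^cR\}$ and $L(c)=(I(c)+\ell I)/\ell I$. $\mathrm{rad}$ denotes the radical (intersection of the maximal submodules); $L(1)$ is a proper submodule of $L=L(0)$. *)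

(* Defs.v *)
From HB Require Import structures.
From mathcomp Require Import all_boot all_order all_fingroup all_algebra.
From mathcomp Require Import boolp classical_sets.

Set Implicit Arguments.
Unset Strict Implicit.
Unset Printing Implicit Defensive.

Import GRing.Theory.

Local Open Scope classical_set_scope.
Local Open Scope ring_scope.
Local Open Scope quotient_scope.

(* The group ring RG, as the functions G -> R under convolution.  A separate
   type name is needed because {ffun G -> R} carries the pointwise product. *)
Definition group_algebra (R : nzRingType) (G : finGroupType) : Type :=
  {ffun G -> R}.

Section GroupAlgebra.
Variables (R : nzRingType) (G : finGroupType).
Local Notation RG := (group_algebra R G).

HB.instance Definition _ := GRing.Lmodule.copy RG {ffun G -> R^o}.

Implicit Types x y z : RG.

Definition ga_coef x (g : G) : R := (x : {ffun G -> R}) g.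

Definition ga_elt (g : G) : RG := [ffun h => (h == g)%:R] : {ffun G -> R}.

Definition ga_mul x y : RG :=
  [ffun g => \sum_h ga_coef x h * ga_coef y (h^-1 * g)%g] : {ffun G -> R}.

Lemma ga_coefP x y : ga_coef x =1 ga_coef y -> x = y.
Proof. by move=> exy; apply/ffunP. Qed.

Lemma ga_coefD x y g : ga_coef (x + y) g = ga_coef x g + ga_coef y g.
Proof. by rewrite /ga_coef [LHS]ffunE. Qed.

Lemma ga_coefB x y g : ga_coef (x - y) g = ga_coef x g - ga_coef y g.
Proof. by rewrite /ga_coef [LHS]ffunE; congr (_ + _); rewrite [LHS]ffunE. Qed.

Lemma ga_coefMn x k g : ga_coef (x *+ k) g = ga_coef x g *+ k.
Proof.
elim: k => [|k IHk]; first by rewrite !mulr0n /ga_coef [LHS]ffunE.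
by rewrite !mulrS ga_coefD IHk.
Qed.

Lemma ga_coefZ (a : R) x g : ga_coef (a *: x) g = a * ga_coef x g.
Proof. by rewrite /ga_coef [LHS]ffunE. Qed.

Lemma ga_coefM x y g :
  ga_coef (ga_mul x y) g = \sum_h ga_coef x h * ga_coef y (h^-1 * g)%g.
Proof. by rewrite /ga_coef [LHS]ffunE. Qed.

Lemma ga_coef_elt g h : ga_coef (ga_elt g) h = (h == g)%:R.
Proof. by rewrite /ga_coef [LHS]ffunE. Qed.

Fact ga_mulA : associative ga_mul.
Proof.
move=> x y z; apply: ga_coefP => g; rewrite !ga_coefM.
under eq_bigr => h _ do rewrite ga_coefM mulr_sumr.
under [RHS]eq_bigr => h _ do rewrite ga_coefM mulr_suml.
rewrite [RHS]exchange_big /=; apply: eq_bigr => h _.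
rewrite [RHS](reindex_inj (mulgI h)) /=; apply: eq_bigr => k _.
by rewrite mulrA invMg !mulgA mulVg mul1g.
Qed.

Fact ga_mul1 : left_id (ga_elt 1%g) ga_mul.
Proof.
move=> x; apply: ga_coefP => g; rewrite ga_coefM (bigD1 1%g) //=.
rewrite big1 => [|h /negPf hn1]; last by rewrite ga_coef_elt hn1 mul0r.
by rewrite ga_coef_elt eqxx mul1r invg1 mul1g addr0.
Qed.

Fact ga_mulr1 : right_id (ga_elt 1%g) ga_mul.
Proof.
move=> x; apply: ga_coefP => g; rewrite ga_coefM (bigD1 g) //=.
rewrite big1 => [|h hng].
  by rewrite ga_coef_elt mulVg eqxx mulr1 addr0.
by rewrite ga_coef_elt -eq_mulVg1 (negPf hng) mulr0.
Qed.

Fact ga_mulDl : left_distributive ga_mul +%R.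
Proof.
move=> x y z; apply: ga_coefP => g; rewrite ga_coefD !ga_coefM -big_split /=.
by apply: eq_bigr => h _; rewrite ga_coefD mulrDl.
Qed.

Fact ga_mulDr : right_distributive ga_mul +%R.
Proof.
move=> x y z; apply: ga_coefP => g; rewrite ga_coefD !ga_coefM -big_split /=.
by apply: eq_bigr => h _; rewrite ga_coefD mulrDr.
Qed.

Fact ga_one_neq0 : ga_elt 1%g != 0.
Proof.
apply/eqP => /(congr1 (fun x => ga_coef x 1%g)) /eqP.
by rewrite ga_coef_elt eqxx /ga_coef ffunE oner_eq0.
Qed.

HB.instance Definition _ := GRing.Zmodule_isNzRing.Build RG
  ga_mulA ga_mul1 ga_mulr1 ga_mulDl ga_mulDr ga_one_neq0.

Fact ga_scaleAl (a : R) (x y : RG) : a *: (x * y) = (a *: x) * y.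
Proof.
apply: ga_coefP => g; rewrite ga_coefZ !ga_coefM mulr_sumr.
by apply: eq_bigr => h _; rewrite ga_coefZ mulrA.
Qed.

HB.instance Definition _ :=
  GRing.Lmodule_isLalgebra.Build R RG ga_scaleAl.

Definition ga_sum (S : {set G}) : RG := \sum_(g in S) ga_elt g.

(* The R-bilinear form with (g, h) |-> delta_{g,h} on group elements *)
Definition ga_form x y : R := \sum_g ga_coef x g * ga_coef y g.

End GroupAlgebra.

Section Modules.
Variables (A : nzRingType) (M : lmodType A).

Definition submodule (N : set M) : Prop := submod_closed (mem N).

Definition maximal_submodule (N : set M) : Prop :=
  [/\ submodule N, N <> setT &
      forall N', submodule N' -> N `<=` N' -> N' = N \/ N' = setT].

Definition radical : set M :=
  [set x | forall N, maximal_submodule N -> N x].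

End Modules.
Arguments radical {A} M.

(* Ideals of R are the submodules of the regular module R^o. *)
Definition ell_ideal (R : nzRingType) (ell : nat) : set R^o :=
  [set a | exists b : R, a = ell%:R * b].
Arguments ell_ideal : clear implicits.

Record local_pid (R : idomainType) (ell : nat) : Prop := LocalPid {
  lpid_principal : forall J : set R^o, submodule J ->
    exists a : R, J = [set x | exists b : R, x = b * a];
  lpid_maximal : maximal_submodule (ell_ideal R ell);
  lpid_local : forall J : set R^o, maximal_submodule J -> J = ell_ideal R ell
}.

Section ResidueRing.
Variables (R : idomainType) (ell : nat) (hR : local_pid R ell).

(* The argument hR makes the ideal recognizably proper, as required for the
   ring structure on the quotient. *)
Definition ell_pred of local_pid R ell : {pred R} :=
  fun a => `[< ell_ideal R ell a >].

Fact ell_pred_idealr : idealr_closed (ell_pred hR).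
Proof.
split.
- by apply/asboolP; exists 0; rewrite mulr0.
- apply/negP => /asboolP [b eb]; have [_ nT _] := lpid_maximal hR.
  apply: nT; apply/seteqP; split=> // a _.
  by exists (b * a); rewrite mulrA -eb mul1r.
- move=> a u v /asboolP[b ->] /asboolP[c ->]; apply/asboolP.
  by exists (a * b + c); rewrite mulrDr mulrCA.
Qed.

HB.instance Definition _ := isIdealr.Build R (ell_pred hR) ell_pred_idealr.

Definition residue_ring : comNzRingType := {ideal_quot (ell_pred hR)}.

Definition residue (a : R) : residue_ring := \pi_{ideal_quot (ell_pred hR)} a.

HB.instance Definition _ := GRing.RMorphism.copy residue
  (\pi_{ideal_quot (ell_pred hR)} : R -> residue_ring).

Definition residue_lift (a : residue_ring) : R :=
  generic_quotient.repr (a : {ideal_quot (ell_pred hR)}).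

Lemma residue_liftK a : residue (residue_lift a) = a.
Proof. exact: reprK. Qed.

Lemma residueP a b : residue a = residue b <-> exists c, a - b = ell%:R * c.
Proof.
split=> [/eqP|eab]; first by rewrite /residue -Quotient.idealrBE => /asboolP.
by apply/eqP; rewrite /residue -Quotient.idealrBE; apply/asboolP.
Qed.

End ResidueRing.

Section SteinbergLattice.
Variables (F : finFieldType) (n : nat).
Local Notation G := {'GL_n[F]}.

Definition borel : {set G} :=
  [set g : G | [forall i : 'I_n.-1.+1, forall j : 'I_n.-1.+1,
     (j < i)%N ==> (GLval g i j == 0)]]%SET.

Definition perm_GL (s : 'S_n.-1.+1) : G := FinRing.unit _ (unitmx_perm F s).

Section Lattice.
Variable R : idomainType.
Local Notation RG := (group_algebra R G).

Definition steinberg_elt : RG :=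
  \sum_(s : 'S_n.-1.+1)
     (-1) ^+ odd_perm s *: (ga_elt R (perm_GL s) * ga_sum R borel).

Definition steinberg_pred : {pred RG^o} :=
  fun x => `[< exists a : RG, x = a * steinberg_elt >].

Fact steinberg_submod : submod_closed steinberg_pred.
Proof.
split; first by apply/asboolP; exists 0; rewrite mul0r.
move=> a u v /asboolP[b ->] /asboolP[c ->]; apply/asboolP.
by exists (a * b + c); rewrite mulrDl -mulrA.
Qed.

HB.instance Definition _ :=
  GRing.isSubmodClosed.Build RG RG^o steinberg_pred steinberg_submod.

Record steinberg : predArgType := Steinberg {
  steinberg_val : RG^o;
  _ : steinberg_val \in steinberg_pred
}.

HB.instance Definition _ := [isSub for steinberg_val].
HB.instance Definition _ := [Choice of steinberg by <:].
HB.instance Definition _ := [SubChoice_isSubLmodule of steinberg by <:].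

(* f takes its values in R; since |B| need not be invertible in R, the division
   is performed in the fraction field. *)
Definition steinberg_form (x y : steinberg) : {fraction R} :=
  FracField.tofrac (@ga_form R G (steinberg_val x) (steinberg_val y)) / #|borel|%:R.

Variable ell : nat.

Definition steinberg_filt (c : nat) : set steinberg :=
  [set x | forall y, exists r : R,
     steinberg_form x y = FracField.tofrac (ell%:R ^+ c * r)].

Definition ell_steinberg : {pred steinberg} :=
  fun x => `[< exists y : steinberg, x = y *+ ell >].

Fact ell_steinberg_zmod : zmod_closed ell_steinberg.
Proof.
split; first by apply/asboolP; exists 0; rewrite mul0rn.
by move=> u v /asboolP[b ->] /asboolP[c ->]; apply/asboolP; exists (b - c);
  rewrite mulrnBl.
Qed.

HB.instance Definition _ :=
  GRing.isZmodClosed.Build steinberg ell_steinberg ell_steinberg_zmod.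

End Lattice.

Section Reduction.
Variables (R : idomainType) (ell : nat) (hR : local_pid R ell).
Local Notation RG := (group_algebra R G).
Local Notation K := (residue_ring hR).
Local Notation KG := (group_algebra K G).
Local Notation I := (steinberg R).

Local Notation Q := (Quotient.quot (@ell_steinberg R ell)).

Definition steinberg_mod of local_pid R ell : Type := Q.
Local Notation L := (steinberg_mod hR).

HB.instance Definition _ :=
  GRing.Zmodule.copy L Q.

Definition steinberg_proj (x : I) : L := \pi_Q x.

Definition ga_reduce (a : RG) : KG :=
  [ffun g => residue hR (ga_coef a g)] : {ffun G -> K}.

Definition ga_lift (a : KG) : RG :=
  [ffun g => residue_lift (ga_coef a g)] : {ffun G -> R}.

(* KG acts on L = I / ell I by lifting scalars to RG and vectors to I; see
   steinberg_projZ for independence of the lifts. *)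
Definition steinberg_scale (a : KG) (x : L) : L :=
  steinberg_proj (ga_lift a *: (generic_quotient.repr (x : Q))).

Lemma ga_liftK a : ga_reduce (ga_lift a) = a.
Proof.
by apply: ga_coefP => g; rewrite /ga_coef [LHS]ffunE /ga_coef ffunE residue_liftK.
Qed.

Lemma steinberg_proj_repr (x : L) :
  steinberg_proj (generic_quotient.repr (x : Q)) = x.
Proof. exact: reprK. Qed.

Lemma steinberg_projD x y :
  steinberg_proj (x + y) = steinberg_proj x + steinberg_proj y.
Proof. exact: (raddfD (\pi_Q)). Qed.

Lemma steinberg_projP x y :
  (steinberg_proj x = steinberg_proj y) <-> (exists z, x - y = z *+ ell).
Proof.
split=> [/eqP|exy].
  by rewrite /steinberg_proj -Quotient.idealrBE => /asboolP.
by apply/eqP; rewrite /steinberg_proj -Quotient.idealrBE; apply/asboolP.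
Qed.

Lemma ga_reduceP a b : ga_reduce a = ga_reduce b -> exists c, a - b = c *+ ell.
Proof.
move=> eab.
have H g : exists c : R, ga_coef a g - ga_coef b g = ell%:R * c.
  have := congr1 (fun x => ga_coef x g) eab.
  by rewrite /ga_coef !ffunE => /residueP.
have [c cP] := choice H.
exists ([ffun g => c g] : {ffun G -> R}); apply: ga_coefP => g.
by rewrite ga_coefB ga_coefMn cP mulr_natl /ga_coef ffunE.
Qed.

Lemma steinberg_projZ (a : RG) (x : I) :
  steinberg_proj (a *: x) = steinberg_scale (ga_reduce a) (steinberg_proj x).
Proof.
rewrite /steinberg_scale; set y := generic_quotient.repr _; set b := ga_lift _.
have [z zP] : exists z, x - y = z *+ ell.
  by apply/steinberg_projP; rewrite steinberg_proj_repr.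
have [c cP] : exists c, a - b = c *+ ell by apply: ga_reduceP; rewrite ga_liftK.
apply/steinberg_projP; exists (c *: x + b *: z).
rewrite mulrnDl scalerMnl -cP scalerMnr -zP scalerBl scalerBr.
by rewrite addrA subrK.
Qed.

Lemma ga_reduceM a b : ga_reduce (a * b) = ga_reduce a * ga_reduce b.
Proof.
apply: ga_coefP => g; rewrite {1}/ga_coef ffunE !ga_coefM rmorph_sum.
by apply: eq_bigr => h _; rewrite rmorphM /ga_coef !ffunE.
Qed.

Lemma ga_reduceD a b : ga_reduce (a + b) = ga_reduce a + ga_reduce b.
Proof.
apply: ga_coefP => g; rewrite {1}/ga_coef ffunE !ga_coefD rmorphD.
by rewrite /ga_coef !ffunE.
Qed.

Lemma ga_reduce1 : ga_reduce 1 = 1.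
Proof.
by apply: ga_coefP => g; rewrite {1}/ga_coef ffunE !ga_coef_elt rmorph_nat.
Qed.

Fact steinberg_scaleA a b x :
  steinberg_scale a (steinberg_scale b x) = steinberg_scale (a * b) x.
Proof.
rewrite -(ga_liftK a) -(ga_liftK b) -(steinberg_proj_repr x).
by rewrite -ga_reduceM -!steinberg_projZ scalerA.
Qed.

Fact steinberg_scale1 : left_id 1 steinberg_scale.
Proof.
move=> x; rewrite -(steinberg_proj_repr x) -ga_reduce1.
by rewrite -steinberg_projZ scale1r.
Qed.

Fact steinberg_scaleDr : right_distributive steinberg_scale +%R.
Proof.
move=> a x y; rewrite -(ga_liftK a) -(steinberg_proj_repr x).
by rewrite -(steinberg_proj_repr y) -steinberg_projD -!steinberg_projZ
  -steinberg_projD scalerDr.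
Qed.

Fact steinberg_scaleDl x : {morph steinberg_scale^~ x : a b / a + b}.
Proof.
move=> a b; rewrite -(ga_liftK a) -(ga_liftK b) -(steinberg_proj_repr x).
by rewrite -ga_reduceD -!steinberg_projZ -steinberg_projD scalerDl.
Qed.

HB.instance Definition _ := GRing.Zmodule_isLmodule.Build KG L
  steinberg_scaleA steinberg_scale1 steinberg_scaleDr steinberg_scaleDl.

Definition steinberg_mod_filt (c : nat) : set L :=
  [set steinberg_proj z | z in
     [set z | exists x y, @steinberg_filt R ell c x /\ z = x + y *+ ell]].

End Reduction.
End SteinbergLattice.

Arguments steinberg_mod F n {R ell} hR.
Arguments steinberg_mod_filt F n {R ell} hR c.

(* Main.v *)
Require Import Defs.
From mathcomp Require Import all_boot all_order all_fingroup all_algebra.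
From mathcomp Require Import all_field.
From mathcomp Require Import boolp classical_sets.
From mathcomp Require Import zify.

Set Implicit Arguments.
Unset Strict Implicit.
Unset Printing Implicit Defensive.

Import GRing.Theory.

Local Open Scope classical_set_scope.
Local Open Scope ring_scope.

(** The proof rests on Whittaker vectors.  Let U be the group of unipotent upper
    triangular matrices, psi a nontrivial additive character of F with values in
    R (it exists because R contains a primitive p-th root of unity), and lambda
    the character of U sending u to psi of the sum of the entries just above the
    diagonal.  Put E = sum over u in U of lambda(u) u.  Three facts imply the
    theorem.

    (1) E I is contained in R E eps ([whit_rank1]).  Indeed I = RU eps
    ([Uspan_lattice]): the span of the U-translates of eps is stable under
    diagonal matrices and, by a computation in GL_2 ([rank1_eps]), under simple
    reflections, and these generate GL together with U.

    (2) E eps generates I up to powers of q, which are invertible modulo ell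
    ([whit_sat_eps]).  One first obtains the vectors E_J eps, where E_J is built
    from the degenerate character which sees only the simple roots in J: for the
    permutation w = w0 w_J, E_J w E eps is a multiple of
    E_J eps by (1), and one of its coefficients is, up to sign, a power of q
    ([whit_pm_coef], [whit_sat_degenerate]).  Then the characters are removed one
    column at a time, from the left.  Let U_k consist of the elements of U whose
    columns of index at most k are trivial.  By Fourier inversion in column k + 1,
    the sum over U_(k+1) is, up to a power of q, the sum over all the extensions
    of the character to U_k.  The extension trivial on that column is covered by
    the induction hypothesis; the other ones are permuted transitively by
    GL_(k+1), so that they are conjugate to an extension which is again covered
    ([colwhit_step]).  At the end U_m = 1 and eps itself is reached.

    (3) f(E eps, eps) = 1 ([ga_form_whit_eps]).

    Let M be a submodule of L, z in I representing an element of M, and y in I.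
    By (2) a power of q times y equals a E eps for some a, and then f(z, y) is,
    up to this power of q, f(E' a* z, eps), where E' is attached to the inverse
    character and a* is the adjoint of a.  By (1) the vector E' a* z is c E' eps
    for some c in R.  If c is invertible modulo ell, then M contains the image of
    E' eps, so M = L by (2) for the inverse character.  Hence a proper M has c in
    ell R for every y, which means that it is contained in L(1).  Finally L(1) is
    a submodule, and it is proper because E eps does not represent one of its
    elements, by (3); so it is the unique maximal submodule. *)

(** * Group algebras and their standard bilinear form *)

Section GroupAlgebraTheory.
Variables (R : comNzRingType) (G : finGroupType).
Local Notation RG := (group_algebra R G).
Implicit Types (x y z : RG) (g h : G) (a : R).

Lemma ga_coef0 g : ga_coef (0 : RG) g = 0.
Proof. by rewrite /ga_coef [LHS]ffunE. Qed.

Lemma ga_coef_sum I (r : seq I) (P : pred I) (X : I -> RG) g :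
  ga_coef (\sum_(i <- r | P i) X i) g = \sum_(i <- r | P i) ga_coef (X i) g.
Proof.
by elim/big_rec2: _ => [|i _ x _ <-]; rewrite ?ga_coef0 // ga_coefD.
Qed.

Lemma ga_coef_eltM g x h : ga_coef (ga_elt R g * x) h = ga_coef x (g^-1 * h)%g.
Proof.
rewrite ga_coefM (bigD1 g) //= big1 ?addr0 => [|k nkg].
  by rewrite ga_coef_elt eqxx mul1r.
by rewrite ga_coef_elt (negPf nkg) mul0r.
Qed.

Lemma ga_coef_mul_elt g x h : ga_coef (x * ga_elt R g) h = ga_coef x (h * g^-1)%g.
Proof.
rewrite ga_coefM (bigD1 (h * g^-1)%g) //= big1 ?addr0 => [|k nk].
  by rewrite ga_coef_elt invMg mulgKV invgK eqxx mulr1.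
rewrite ga_coef_elt -(inj_eq (mulgI k)) mulKVg -(inj_eq (mulIg g^-1)%g) mulgK.
by rewrite eq_sym (negPf nk) mulr0.
Qed.

Lemma ga_eltM g h : ga_elt R (g * h)%g = ga_elt R g * ga_elt R h.
Proof.
apply: ga_coefP => k; rewrite ga_coef_eltM !ga_coef_elt.
by rewrite -[in RHS](inj_eq (mulgI g)) mulKVg.
Qed.

Lemma ga_coef_set (S : {set G}) h : ga_coef (ga_sum R S) h = (h \in S)%:R.
Proof.
rewrite ga_coef_sum; case: (boolP (h \in S)) => hS.
  rewrite (bigD1 h) //= ga_coef_elt eqxx big1 ?addr0 // => k /andP[_ nk].
  by rewrite ga_coef_elt eq_sym (negPf nk).
rewrite big1 // => k kS; rewrite ga_coef_elt.
by case: eqP kS hS => // -> ->.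
Qed.

Lemma ga_scaleAr a x y : x * (a *: y) = a *: (x * y).
Proof.
apply: ga_coefP => g; rewrite ga_coefZ !ga_coefM mulr_sumr.
by apply: eq_bigr => h _; rewrite ga_coefZ mulrCA.
Qed.

Lemma ga_sum_coef x : x = \sum_g ga_coef x g *: ga_elt R g.
Proof.
apply: ga_coefP => g; rewrite ga_coef_sum (bigD1 g) //= big1 ?addr0 => [|h nh].
  by rewrite ga_coefZ ga_coef_elt eqxx mulr1.
by rewrite ga_coefZ ga_coef_elt eq_sym (negPf nh) mulr0.
Qed.

Definition ga_adj x : RG := \sum_g ga_coef x g *: ga_elt R g^-1%g.

Lemma ga_formC x y : ga_form x y = ga_form y x.
Proof. by apply: eq_bigr => g _; rewrite mulrC. Qed.

Lemma ga_formDl x y z : ga_form (x + y) z = ga_form x z + ga_form y z.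
Proof.
by rewrite -big_split; apply: eq_bigr => g _; rewrite ga_coefD mulrDl.
Qed.

Lemma ga_formZl a x y : ga_form (a *: x) y = a * ga_form x y.
Proof. by rewrite mulr_sumr; apply: eq_bigr => g _; rewrite ga_coefZ mulrA. Qed.

Lemma ga_form0l x : ga_form 0 x = 0.
Proof. by rewrite -(scale0r (0 : RG)) ga_formZl mul0r. Qed.

Lemma ga_form_suml I (r : seq I) (P : pred I) (X : I -> RG) y :
  ga_form (\sum_(i <- r | P i) X i) y = \sum_(i <- r | P i) ga_form (X i) y.
Proof.
by elim/big_rec2: _ => [|i _ x _ <-]; rewrite ?ga_form0l // ga_formDl.
Qed.

Lemma ga_formZr a x y : ga_form x (a *: y) = a * ga_form x y.
Proof. by rewrite ga_formC ga_formZl ga_formC. Qed.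

Lemma ga_form_sumr I (r : seq I) (P : pred I) (X : I -> RG) y :
  ga_form y (\sum_(i <- r | P i) X i) = \sum_(i <- r | P i) ga_form y (X i).
Proof.
by rewrite ga_formC ga_form_suml; apply: eq_bigr => i _; rewrite ga_formC.
Qed.

Lemma ga_form_elt x g : ga_form x (ga_elt R g) = ga_coef x g.
Proof.
rewrite /ga_form (bigD1 g) //= ga_coef_elt eqxx mulr1 big1 ?addr0 // => h nh.
by rewrite ga_coef_elt (negPf nh) mulr0.
Qed.

Lemma ga_form_eltM g x y :
  ga_form (ga_elt R g * x) y = ga_form x (ga_elt R g^-1%g * y).
Proof.
rewrite /ga_form (reindex_inj (mulgI g)); apply: eq_bigr => h _.
by rewrite !ga_coef_eltM mulKg invgK.
Qed.

Lemma ga_form_Melt g x y :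
  ga_form (x * ga_elt R g) y = ga_form x (y * ga_elt R g^-1%g).
Proof.
rewrite /ga_form (reindex_inj (mulIg g)); apply: eq_bigr => h _.
by rewrite !ga_coef_mul_elt mulgK invgK.
Qed.

Lemma ga_form_adj z x y : ga_form x (z * y) = ga_form (ga_adj z * x) y.
Proof.
rewrite {1}[z]ga_sum_coef !mulr_suml ga_form_suml ga_form_sumr.
apply: eq_bigr => g _; rewrite -!scalerAl ga_formZr ga_formZl.
by rewrite ga_form_eltM invgK.
Qed.

End GroupAlgebraTheory.

(** * Matrices and subgroups of the general linear group *)

(** A group identified with GL_{m+1}(F): [mx g] is the matrix of g and [pm s]
    is the element whose matrix is that of the permutation s.  The arguments
    below only use this identification, never the construction of GL. *)
Record gl_group (F : finFieldType) (m : nat) := GLGroup {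
  gl_grp :> finGroupType;
  mx : gl_grp -> 'M[F]_m.+1;
  pm : 'S_m.+1 -> gl_grp;
  mxM : forall g h, mx (g * h)%g = mx g *m mx h;
  mx1 : mx 1%g = 1%:M;
  mx_inj : injective mx;
  mx_unit : forall g, mx g \in unitmx;
  mx_surj : forall A, A \in unitmx -> exists g, mx g = A;
  pm_mx : forall s, mx (pm s) = perm_mx s
}.
Arguments pm {F m}.

Section MatrixGroups.
Variables (F : finFieldType) (m : nat) (G : gl_group F m).
Local Notation N := m.+1.
Implicit Types (g h u v : G) (s t : 'S_N) (i j k : 'I_N).

Definition bor : {set G} :=
  [set g : G | [forall i : 'I_N, forall j : 'I_N,
     (j < i)%N ==> (mx g i j == 0)]]%SET.
Local Notation B := bor.

Lemma borelP g : reflect (forall i j, (j < i)%N -> mx g i j = 0) (g \in B).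
Proof.
rewrite inE; apply: (iffP forallP) => [Bg i j ltji | Bg i].
  by have /forallP/(_ j)/implyP/(_ ltji)/eqP := Bg i.
by apply/forallP => j; apply/implyP => ltji; rewrite Bg.
Qed.

(** For a closed set Phi of positive roots this is the product of the root
    subgroups of Phi.  All the unipotent groups below are of this kind, and
    [card_pattern] gives their orders whether or not Phi is closed. *)
Definition pattern (Phi : rel 'I_N) : {set G} :=
  [set g : G | [forall i, forall j, Phi i j || (mx g i j == (i == j)%:R)]]%SET.

Lemma patternP Phi g :
  reflect (forall i j, ~~ Phi i j -> mx g i j = (i == j)%:R) (g \in pattern Phi).
Proof.
rewrite inE; apply: (iffP forallP) => [Pg i j nP | Pg i].
  by have /forallP/(_ j) := Pg i; rewrite (negPf nP) => /eqP.
by apply/forallP => j; case: (boolP (Phi i j)) => // /Pg ->; rewrite eqxx.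
Qed.

Definition uni : {set G} := pattern (fun i j => (i < j)%N).

Lemma uniP g :
  reflect (forall i j, (j <= i)%N -> mx g i j = (i == j)%:R) (g \in uni).
Proof.
rewrite /uni; apply: (iffP (patternP (fun i j => (i < j)%N) g)) => H i j le.
  by apply: (H i j); rewrite -leqNgt.
by apply: (H i j); rewrite leqNgt.
Qed.

Lemma pattern_uni (Phi : rel 'I_N) :
  (forall i j, Phi i j -> (i < j)%N) -> pattern Phi \subset uni.
Proof.
move=> ltP; apply/fintype.subsetP => g /patternP Pg; apply/patternP => i j nlt.
by apply: Pg; apply: contra nlt; apply: ltP.
Qed.

Lemma uni_diag u i : u \in uni -> mx u i i = 1.
Proof. by move/uniP->; rewrite ?eqxx. Qed.

Lemma uni_borel : uni \subset B.
Proof.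
apply/fintype.subsetP => u /uniP Uu; apply/borelP => i j ltji.
by rewrite Uu ?(ltnW ltji) // -val_eqE /= gtn_eqF.
Qed.

Lemma uni_group_set : group_set uni.
Proof.
apply/group_setP; split=> [|u v /uniP Uu /uniP Uv].
  by apply/uniP => i j _; rewrite mx1 !mxE.
apply/uniP => i j leji; rewrite mxM mxE (bigD1 i) //= Uu // eqxx mul1r.
rewrite Uv // big1 ?addr0 // => k nki.
case: (ltnP i k) => [ltik|leki]; last by rewrite Uu // eq_sym (negPf nki) mul0r.
rewrite Uv ?(leq_trans leji (ltnW ltik)) // -val_eqE /=.
by rewrite gtn_eqF ?mulr0 // (leq_ltn_trans leji ltik).
Qed.
Canonical uni_group := Group uni_group_set.

Lemma borel_group_set : group_set B.
Proof.
apply/group_setP; split=> [|u v /borelP Bu /borelP Bv].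
  by apply/borelP => i j ltji; rewrite mx1 !mxE -val_eqE /= gtn_eqF.
apply/borelP => i j ltji; rewrite mxM mxE big1 // => k _.
case: (ltnP k i) => [ltki|leik]; first by rewrite Bu ?mul0r.
by rewrite Bv ?mulr0 // (leq_trans ltji leik).
Qed.
Canonical borel_group := Group borel_group_set.

Lemma borel_diag_neq0 b i : b \in B -> mx b i i != 0.
Proof.
move=> /borelP Bb; have := mx_unit b.
rewrite unitmxE unitfE -det_tr det_trig; last first.
  by apply/is_trig_mxP => j k ltjk; rewrite mxE Bb.
by move=> /prodf_neq0/(_ i isT); rewrite mxE.
Qed.

Definition unip (X : 'M[F]_N) : G := odflt 1%g [pick g | mx g == 1%:M + X].

Lemma unipE (X : 'M[F]_N) :
  (forall i j, (j <= i)%N -> X i j = 0) -> mx (unip X) = 1%:M + X.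
Proof.
move=> X0; rewrite /unip.
suff /(@mx_surj _ _ G)[g eg] : 1%:M + X \in unitmx.
  case: pickP => [h /eqP // | /(_ g)]; by rewrite eg eqxx.
rewrite unitmxE -det_tr det_trig.
  rewrite big1 ?unitr1 // => i _.
  by rewrite !mxE eqxx X0 // addr0.
apply/is_trig_mxP => i j ltij.
by rewrite !mxE X0 ?(ltnW ltij) // addr0 -val_eqE /= gtn_eqF.
Qed.

Lemma card_pattern (Phi : rel 'I_N) :
  (forall i j, Phi i j -> (i < j)%N) ->
  #|pattern Phi| = (#|F| ^ #|[pred p : 'I_N * 'I_N | Phi p.1 p.2]|)%N.
Proof.
move=> ltP; set D := [pred p | _].
pose X (f : {ffun 'I_N * 'I_N -> F}) : 'M[F]_N := \matrix_(i, j) f (i, j).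
pose S := [set f in pffun_on (0 : F) D predT]%SET.
have Sup f : f \in S -> forall i j, ~~ Phi i j -> f (i, j) = 0.
  rewrite inE => /pffun_onP[/supportP sup _] i j nP; exact: sup.
have Sval f : f \in S -> mx (unip (X f)) = 1%:M + X f.
  move=> Sf; apply: unipE => i j leji; rewrite mxE (Sup f) //.
  by apply: contraL leji => /ltP; rewrite -ltnNge.
have <- : #|S| = (#|F| ^ #|D|)%N.
  by rewrite cardsE card_pffun_on; congr (_ ^ _)%N; apply: eq_card.
have <- : [set unip (X f) | f in S]%SET = pattern Phi.
  apply/setP => g; apply/imsetP/patternP => [[f Sf ->] i j nP | Pg].
    by rewrite Sval // !mxE (Sup f) // addr0.
  pose f : {ffun 'I_N * 'I_N -> F} :=
    [ffun p => if D p then mx g p.1 p.2 else 0].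
  have Sf : f \in S.
    rewrite inE; apply/pffun_onP; split=> //; apply/supportP => p nD.
    by rewrite ffunE ifN.
  exists f => //; apply: mx_inj; rewrite Sval //; apply/matrixP => i j.
  rewrite !mxE ffunE /=; case: ifP => [/ltP ltij|/negbT nP].
    by rewrite -val_eqE /= ltn_eqF // add0r.
  by rewrite addr0 Pg.
rewrite card_in_imset // => f1 f2 Sf1 Sf2 /(congr1 (@mx _ _ G)).
rewrite !Sval // => /addrI/matrixP e; apply/ffunP => -[i j].
by have := e i j; rewrite !mxE.
Qed.

Lemma pmM s t : pm G (s * t)%g = (pm G s * pm G t)%g.
Proof. by apply: mx_inj; rewrite mxM !pm_mx perm_mxM. Qed.

Lemma pm1 : pm G (1%g : 'S_N) = 1%g.
Proof. by apply: mx_inj; rewrite mx1 pm_mx perm_mx1. Qed.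

Lemma pmV s : pm G s^-1%g = (pm G s)^-1%g.
Proof. by apply: (mulgI (pm G s)); rewrite -pmM !mulgV pm1. Qed.

Lemma mul_pm s g i j : mx (pm G s * g)%g i j = mx g (s i) j.
Proof. by rewrite mxM pm_mx -row_permE mxE. Qed.

Lemma mul_mx_pm s g i j : mx (g * pm G s)%g i (s j) = mx g i j.
Proof.
by rewrite mxM pm_mx -[s in perm_mx s]invgK
  -col_permE mxE permK.
Qed.

Lemma conj_pm s t g i j :
  mx ((pm G t)^-1 * g * pm G s)%g (t i) (s j) = mx g i j.
Proof. by rewrite mul_mx_pm -pmV mul_pm permK. Qed.

Lemma perm_le_eq s t : (forall i, (t i <= s i)%N) -> s = t.
Proof.
move=> le_ts.
have sumE (r : 'S_N) : (\sum_i (r i : nat) = \sum_(i < N) i)%N.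
  by rewrite [RHS](reindex_inj (@perm_inj _ r)).
have [i _|_] := @leqif_sum _ predT (fun i => t i == s i) (fun i => t i : nat)
    (fun i => s i : nat).
  by split.
rewrite !sumE eqxx => /esym/forall_inP e; apply/permP => i.
by apply/eqP; rewrite eq_sym e.
Qed.

(** Disjointness of the Bruhat cells: the diagonal entries of u are nonzero, so
    s and t can only be related by t <= s pointwise, which forces s = t. *)
Lemma bruhat_inj s t u :
  u \in uni -> ((pm G t)^-1 * u * pm G s)%g \in B -> s = t.
Proof.
move=> Uu /borelP Bsut; apply: perm_le_eq => i; rewrite leqNgt.
apply/negP => /Bsut; rewrite conj_pm uni_diag // => /eqP.
by rewrite oner_eq0.
Qed.

(** Conjugating by s turns triangularity into triangularity for the order of
    the indices i given by s i; this describes both s B s^-1 and, for s = w0,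
    the opposite Borel subgroup. *)
Lemma conj_borelP s g :
  reflect (forall i j, (s j < s i)%N -> mx g i j = 0)
          (((pm G s)^-1 * g * pm G s)%g \in B).
Proof.
apply: (iffP (borelP _)) => H i j lt; first by rewrite -(H _ _ lt) conj_pm.
by rewrite -(permKV s i) -(permKV s j) conj_pm H // !permKV.
Qed.

Definition w0 : 'S_N := perm (@rev_ord_inj N).

Lemma conj_w0P g :
  reflect (forall i j, (i < j)%N -> mx g i j = 0)
          (((pm G w0)^-1 * g * pm G w0)%g \in B).
Proof.
apply: (iffP (conj_borelP _ _)) => H i j lt; apply: H.
  by rewrite !permE /=; have := ltn_ord i; have := ltn_ord j; lia.
by move: lt; rewrite !permE /=; have := ltn_ord i; have := ltn_ord j; lia.
Qed.

End MatrixGroups.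

(** * The Steinberg lattice is spanned by the U-translates of its generator *)

Section SteinbergBasis.
Variables (F : finFieldType) (m : nat) (G : gl_group F m) (R : idomainType).
Local Notation N := m.+1.
Local Notation B := (bor G).
Local Notation U := (uni G).
Local Notation RG := (group_algebra R G).
Local Notation "[ 'g' x ]" := (ga_elt R x) (format "[ 'g'  x ]").
Implicit Types (g h u v : G) (s t : 'S_N) (i j k : 'I_N) (x y : RG).

(** The cosets of B are the complete flags; this is gB as an element of RG. *)
Definition flag g : RG := [g g] * ga_sum R B.

Lemma ga_coef_flag g h : ga_coef (flag g) h = (g^-1 * h \in B)%g%:R.
Proof. by rewrite ga_coef_eltM ga_coef_set. Qed.

Lemma flagP g h : (g^-1 * h)%g \in B -> flag g = flag h.
Proof.
move=> Bgh; apply: ga_coefP => k; rewrite !ga_coef_flag.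
by rewrite -[in LHS](mulKVg h k) mulgA groupMl.
Qed.

Lemma elt_flag g h : [g g] * flag h = flag (g * h)%g.
Proof. by rewrite [flag h]/flag mulrA -ga_eltM. Qed.

Definition eps : RG := \sum_s (-1) ^+ odd_perm s *: flag (pm G s).

Lemma elt_eps g :
  [g g] * eps = \sum_s (-1) ^+ odd_perm s *: flag (g * pm G s)%g.
Proof.
by rewrite mulr_sumr; apply: eq_bigr => s _; rewrite ga_scaleAr elt_flag.
Qed.

Lemma perm_eps s : [g pm G s] * eps = (-1) ^+ odd_perm s *: eps.
Proof.
rewrite elt_eps /eps scaler_sumr [RHS](reindex_inj (mulgI s)) /=.
apply: eq_bigr => t _.
by rewrite pmM scalerA -signr_addb odd_permM addKb.
Qed.

(** Grouping s with (i j)s gives the vanishing in any characteristic. *)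
Lemma alternating_sum0 i j (X : 'S_N -> RG) : i != j ->
  (forall s, X (tperm i j * s)%g = X s) ->
  \sum_s (-1) ^+ odd_perm s *: X s = 0.
Proof.
move=> nij Xs; rewrite (bigID (fun s : 'S_N => s i < s j)%N) /=.
rewrite [X in _ + X](reindex_inj (mulgI (tperm i j))) /=.
rewrite [X in _ + X](eq_bigl (fun s : 'S_N => s i < s j)%N) => [|s]; last first.
  rewrite !permM tpermL tpermR -leqNgt leq_eqVlt val_eqE (inj_eq perm_inj).
  by rewrite (negPf nij).
rewrite -big_split big1 // => s _ /=.
by rewrite Xs odd_permM odd_tperm nij /= signrN scaleNr subrr.
Qed.

Definition elem i j (a : F) : G := unip G (a *: delta_mx i j).

Lemma elemE i j a : (i < j)%N -> mx (elem i j a) = 1%:M + a *: delta_mx i j.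
Proof.
move=> ltij; apply: unipE => x y leyx; rewrite !mxE.
case: (x =P i) => [ex|_]; case: (y =P j) => [ey|_]; rewrite ?mulr0 //.
by move: leyx; rewrite ex ey leqNgt ltij.
Qed.

Lemma elem_uni i j a : (i < j)%N -> elem i j a \in U.
Proof.
move=> ltij; apply/uniP => x y leyx; rewrite elemE // !mxE.
case: (x =P i) => [ex|_]; case: (y =P j) => [ey|_]; rewrite ?mulr0 ?addr0 //.
by move: leyx; rewrite ex ey leqNgt ltij.
Qed.

Lemma elemD i j a b : (i < j)%N -> elem i j (a + b) = (elem i j a * elem i j b)%g.
Proof.
move=> ltij; apply: mx_inj; rewrite mxM !elemE // mulmxDl mul1mx mulmxDr mulmx1.
rewrite -scalemxAl -scalemxAr mul_delta_mx_0 ?scaler0 ?addr0; last first.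
  by rewrite -val_eqE /= gtn_eqF.
by rewrite scalerDl addrA addrAC.
Qed.

Lemma elem0 i j : (i < j)%N -> elem i j 0 = 1%g.
Proof.
by move=> ltij; apply: mx_inj; rewrite elemE // scale0r addr0 mx1.
Qed.

Lemma elemV i j a : (i < j)%N -> elem i j (- a) = (elem i j a)^-1%g.
Proof.
move=> ltij; apply: (mulgI (elem i j a)).
by rewrite -elemD // subrr elem0 // mulgV.
Qed.

Lemma elem_flag i j a s : (i < j)%N -> (s i < s j)%N ->
  flag (elem i j a * pm G s)%g = flag (pm G s).
Proof.
move=> ltij ltsij; apply: flagP; rewrite invMg -elemV // -mulgA mulgA.
apply/conj_borelP => x y ltyx; rewrite elemE // !mxE.
case: (x =P i) ltyx => [->|_]; case: (y =P j) => [->|_]; rewrite ?mulr0 ?addr0.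
- by rewrite ltnNge (ltnW ltsij).
- by case: eqP => // ->; rewrite ltnn.
- by case: eqP => // ->; rewrite ltnn.
- by case: eqP => // ->; rewrite ltnn.
Qed.

(** With p the transposition (i j) and x(a) the elementary matrix, the Bruhat
    relation p x(a) p = x(a^-1) p b of GL_2 has b upper triangular, with its
    only off-diagonal entry in place (i, j); as s i < s j, the conjugate of b
    by s is still upper triangular. *)
Lemma bruhat_rank1 i j a s : (i < j)%N -> (s i < s j)%N -> a != 0 ->
  flag (pm G (tperm i j) * elem i j a * pm G (tperm i j * s)%g)%g
    = flag (elem i j (a^-1)%R * pm G (tperm i j * s)%g)%g.
Proof.
move=> ltij ltsij a0; have nij : (i == j) = false by rewrite -val_eqE /= ltn_eqF.
have nji : (j == i) = false by rewrite eq_sym.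
apply/esym/flagP; rewrite pmM; set p := pm G (tperm i j).
have pV : (p^-1 = p)%g by rewrite -pmV tpermV.
have -> : ((elem i j (a^-1)%R * (p * pm G s))^-1 *
           (p * elem i j a * (p * pm G s)) =
   (pm G s)^-1 * ((p * (elem i j (- a^-1)%R) * p) * elem i j a * p) *
    pm G s)%g.
  by rewrite elemV // !invMg pV !mulgA.
apply/conj_borelP => x y ltyx.
rewrite -(tpermK i j y) mul_mx_pm mxM elemE //.
have [P -> PE] : exists2 P : 'M[F]_N, mx (p * elem i j (- a^-1)%R * p)%g = P &
    forall (x1 y1 : 'I_N), P x1 y1 =
    (x1 == y1)%:R - a^-1 * ((x1 == j) && (y1 == i))%:R.
  exists (mx (p * elem i j (- a^-1)%R * p)%g) => // x1 y1.
  rewrite -{1}(tpermK i j y1) mul_mx_pm mul_pm elemE // !mxE.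
  rewrite (inj_eq perm_inj) !(canF_eq (tpermK i j)) tpermL tpermR.
  by rewrite mulNr.
rewrite mulmxDr mulmx1 -scalemxAr !mxE (bigD1 i) //= big1 ?addr0 => [|k nki]; last first.
  by rewrite mxE (negPf nki) mulr0.
rewrite !PE !mxE !eqxx /= andbT.
case: (tpermP i j y) ltyx => [->|->|/eqP nyi /eqP nyj] ltyx.
- rewrite eqxx nji !(andbF, andbT) mulr0 subr0 mulr1.
  case: (x =P i) ltyx => [->|_ _]; first by rewrite ltnn.
  by case: (x =P j) => _; rewrite ?mulr1 ?mulr0 sub0r mulrN ?mulfV ?mulr0 ?subrr ?subr0.
- rewrite ?eqxx ?andbT ?nij ?nji !mulr0 addr0.
  case: (x =P i) ltyx => [->|_]; first by rewrite ltnNge (ltnW ltsij).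
  by case: (x =P j) => [->|]; rewrite ?ltnn ?mulr0 ?subr0.
- rewrite (negPf nyi) eq_sym (negPf nyj) !andbF !mulr0 subr0 addr0.
  by case: eqP ltyx => // ->; rewrite ltnn.
Qed.

(** The relation that makes the span of the U-translates of eps stable under
    simple reflections.  Pairing s with (i j)s, one of the two satisfies
    s i < s j, so that x(a) fixes its coset and the previous lemma applies to
    the other one. *)
Lemma rank1_eps i j a : (i < j)%N -> a != 0 ->
  [g pm G (tperm i j) * elem i j a] * eps = [g elem i j (a^-1)%R] * eps - eps.
Proof.
move=> ltij a0; have nij : i != j by rewrite -val_eqE /= ltn_eqF.
set p := pm G _; set v := elem i j a; set v' := elem i j _.
pose X s := flag (p * v * pm G s)%g - flag (v' * pm G s)%g
            + flag (pm G s).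
have good s : (s i < s j)%N -> X (tperm i j * s)%g = X s.
  move=> ltsij; have e0 := bruhat_rank1 ltij ltsij a0.
  have e1 : flag (v' * pm G s)%g = flag (pm G s) by exact: elem_flag.
  have e2 : flag (p * v * pm G s)%g = flag (p * pm G s)%g.
    transitivity ([g p] * flag (v * pm G s)%g); first by rewrite elt_flag mulgA.
    by rewrite (elem_flag a ltij ltsij) elt_flag.
  have cancel (x y z : RG) : x - x + y = y - z + z by rewrite subrr add0r subrK.
  rewrite /X e0 e1 e2 pmM; exact: cancel.
have /eqP : \sum_s (-1) ^+ odd_perm s *: X s = 0.
  apply: (alternating_sum0 nij) => s.
  case: (ltnP (s i) (s j)) => [/good // | lesji].
  have ltsji : ((tperm i j * s)%g i < (tperm i j * s)%g j)%N.
    rewrite !permM tpermL tpermR.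
    by rewrite ltn_neqAle lesji val_eqE (inj_eq perm_inj) eq_sym nij.
  by rewrite -(good _ ltsji) mulgA tperm2 mul1g.
under eq_bigr => s _ do rewrite scalerDr scalerBr.
rewrite big_split sumrB /= -!elt_eps -/eps => /eqP X0.
by apply/eqP; rewrite -subr_eq0 opprB addrA addrAC X0.
Qed.

End SteinbergBasis.

Section UnipotentSpan.
Variables (F : finFieldType) (m : nat) (G : gl_group F m) (R : idomainType).
Local Notation N := m.+1.
Local Notation B := (bor G).
Local Notation U := (uni G).
Local Notation RG := (group_algebra R G).
Local Notation eps := (eps G R).
Local Notation "[ 'g' x ]" := (ga_elt R x) (format "[ 'g'  x ]").
Implicit Types (g h u v : G) (s t : 'S_N) (i j k : 'I_N) (x y : RG).

Definition wsum (S : {set G}) (c : G -> R) : RG := \sum_(u in S) c u *: [g u].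

Definition Uspan x := exists c : G -> R, x = wsum U c * eps.

Lemma Uspan0 : Uspan 0.
Proof.
exists (fun _ => 0); rewrite /wsum big1 ?mul0r // => u _.
by rewrite scale0r.
Qed.

Lemma UspanD x y : Uspan x -> Uspan y -> Uspan (x + y).
Proof.
move=> [c ->] [d ->]; exists (fun u => c u + d u); rewrite -mulrDl; congr (_ * _).
by rewrite /wsum -big_split; apply: eq_bigr => u _; rewrite scalerDl.
Qed.

Lemma UspanZ (a : R) x : Uspan x -> Uspan (a *: x).
Proof.
move=> [c ->]; exists (fun u => a * c u); rewrite scalerAl; congr (_ * _).
by rewrite /wsum scaler_sumr; apply: eq_bigr => u _; rewrite scalerA.
Qed.

Lemma Uspan_sum I (r : seq I) (P : pred I) (X : I -> RG) :
  (forall z, P z -> Uspan (X z)) -> Uspan (\sum_(z <- r | P z) X z).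
Proof. by move=> UX; apply: big_rec => [|z x /UX]; [exact: Uspan0 | exact: UspanD]. Qed.

Lemma Uspan_uni u : u \in U -> Uspan ([g u] * eps).
Proof.
move=> Uu; exists (fun v => (v == u)%:R); congr (_ * _).
rewrite /wsum (bigD1 u) //= eqxx scale1r big1 ?addr0 // => v /andP[_ nvu].
by rewrite (negPf nvu) scale0r.
Qed.

Definition stab g := forall x, Uspan x -> Uspan ([g g] * x).

Lemma stabP g : (forall u, u \in U -> Uspan ([g g * u] * eps)) -> stab g.
Proof.
move=> Ug x [c ->]; rewrite /wsum mulr_suml mulr_sumr.
apply: Uspan_sum => u Uu; rewrite -scalerAl ga_scaleAr mulrA -ga_eltM.
exact/UspanZ/Ug.
Qed.

Lemma stabM g h : stab g -> stab h -> stab (g * h)%g.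
Proof. by move=> Sg Sh x Ux; rewrite ga_eltM -mulrA; apply/Sg/Sh. Qed.

Lemma stab1 : stab 1%g.
Proof. by move=> x Ux; rewrite -[[g 1%g]]/(1 : RG) mul1r. Qed.

(** Write b = u h with u in U and h diagonal; h fixes all the cosets sB. *)
Lemma stab_borel b : b \in B -> stab b.
Proof.
move=> Bb; apply: stabP => u Uu.
have {}Bb : (b * u)%g \in B by rewrite groupM // (fintype.subsetP (uni_borel G)).
move: (b * u)%g Bb => {u Uu}b Bb.
pose X : 'M[F]_N := \matrix_(i, j) (if (i < j)%N then mx b i j / mx b j j else 0).
pose u := unip G X.
have uE : mx u = 1%:M + X.
  by apply: unipE => i j leji; rewrite mxE ltnNge leji.
have Uu : u \in U.
  apply/uniP => i j leji; rewrite uE !mxE ltnNge leji /= addr0 //.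
pose D : 'M[F]_N := diag_mx (\row_j mx b j j).
have uD : mx u *m D = mx b.
  apply/matrixP => i j; rewrite uE mulmxDl mul1mx mxE mul_mx_diag !mxE.
  case: (ltngtP i j) => [ltij|ltji|eij].
  - by rewrite -val_eqE /= ltn_eqF // mulr0n add0r divfK // borel_diag_neq0.
  - rewrite mul0r addr0 -val_eqE /= gtn_eqF // mulr0n.
    by have /borelP-> := Bb.
  - by rewrite (val_inj eij) eqxx mulr1n mul0r addr0.
have hD : mx (u^-1 * b)%g = D.
  apply: (can_inj (mulKmx (mx_unit u))); rewrite -mxM mulKVg uD //.
have -> : [g b] * eps = [g u] * eps.
  rewrite !elt_eps; apply: eq_bigr => s _; congr (_ *: _); apply/esym/flagP.
  rewrite invMg -mulgA [X in (_ * X)%g]mulgA mulgA; apply/conj_borelP => i j ltji.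
  rewrite hD !mxE; case: eqP ltji => [->|]; first by rewrite ltnn.
  by rewrite mulr0n.
exact: Uspan_uni.
Qed.

(** Write u = u' x(a) with u' having entry 0 in place (i, j); as i and j are
    adjacent, s normalizes the group of such u', and [rank1_eps] takes care of
    s x(a) unless a = 0. *)
Lemma stab_adjacent i j : j = i.+1 :> nat -> stab (pm G (tperm i j)).
Proof.
move=> ji; have ltij : (i < j)%N by rewrite ji.
have nij : i != j by rewrite -val_eqE /= ltn_eqF.
apply: stabP => u Uu; set s := pm G _; set a := mx u i j.
pose u' := (u * elem G i j (- a))%g.
have Uu' : u' \in U by rewrite groupM // elem_uni.
have u'ij : mx u' i j = 0.
  rewrite mxM elemE // mulmxDr mulmx1 -scalemxAr !mxE (bigD1 i) //= big1 => [|k nk].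
    by rewrite !mxE !eqxx uni_diag // addr0 !mulr1 addrN.
  by rewrite !mxE (negPf nk) mulr0.
have sV : (s^-1 = s)%g by rewrite -pmV tpermV.
have Usu's : (s * u' * s)%g \in U.
  apply/uniP => x y leyx; rewrite -{1}(tpermK i j y) mul_mx_pm mul_pm.
  case: (leqP (tperm i j y) (tperm i j x)) => [le|lt].
    by move/uniP: Uu' => ->//; rewrite (inj_eq perm_inj).
  have [-> ->] : x = j /\ y = i.
    by move: lt leyx; do 2![case: tpermP => [->|->|/eqP + /eqP +]];
      rewrite -?val_eqE //= ?ltnn //; lia.
  by rewrite tpermL tpermR u'ij eq_sym (negPf nij).
have -> : [g s * u] * eps = [g s * u' * s] * ([g s * elem G i j a] * eps).
  rewrite mulrA -ga_eltM; congr (ga_elt _ _ * _).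
  have ss : (s * s = 1)%g by rewrite -{1}sV mulVg.
  rewrite [RHS]mulgA -(mulgA (s * u')%g s s) ss mulg1 -mulgA /u' elemV //.
  by rewrite mulgKV.
case: (eqVneq a 0) => [->|a0].
  rewrite elem0 // mulg1 perm_eps odd_tperm nij ga_scaleAr.
  exact/UspanZ/Uspan_uni.
rewrite rank1_eps // mulrBr mulrA -ga_eltM -scaleN1r; apply: UspanD.
  by apply: Uspan_uni; rewrite groupM // elem_uni.
exact/UspanZ/Uspan_uni.
Qed.

Lemma stab_tperm i j : stab (pm G (tperm i j)).
Proof.
wlog leij : i j / (i <= j)%N.
  by move=> IH; case: (leqP i j) => [|/ltnW] /IH //; rewrite tpermC.
have [d] := ubnP (nat_of_ord j); elim: d j leij => // d IH j leij ltjd.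
case: (ltngtP i j) leij => // [ltij _|eij _]; last first.
  by rewrite (val_inj eij) tperm1 pm1; exact: stab1.
have Nj : (j.-1 < N)%N by have := ltn_ord j; lia.
pose k := Ordinal Nj; have jk : j = k.+1 :> nat by rewrite /=; lia.
have Sk := stab_adjacent jk.
have lik : (i <= k)%N by rewrite /=; lia.
case: (eqVneq i k) => [->//|nik].
have -> : tperm i j = (tperm k j * tperm i k * tperm k j)%g.
  rewrite -{1}(tpermV k j) -mulgA -/(conjg _ _) tpermJ tpermL tpermD //.
  - by rewrite eq_sym.
  - by rewrite -val_eqE /= gtn_eqF.
rewrite !pmM; do 2?apply: stabM => //; apply: IH => //=; lia.
Qed.

Lemma stab_perm s : stab (pm G s).
Proof.
have [ts -> _] := prod_tpermP s; elim/big_rec: _ => [|t {}s _ Ss].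
  by rewrite pm1; apply: stab1.
by rewrite pmM; apply: stabM Ss; apply: stab_tperm.
Qed.

(** The LUP decomposition shows that B and the permutation matrices generate
    the group, since a lower triangular matrix is w0 b w0 with b in B. *)
Lemma stab_all g : stab g.
Proof.
have := cormen_lup_correct (mx g); have := cormen_lup_perm (mx g).
have := cormen_lup_lower (mx g); have := cormen_lup_upper (mx g).
have := cormen_lup_detL (mx g); case: cormen_lup => [[P L] V] /= detL Vu Ll.
case/is_perm_mxP => s -> /= eqLV.
have uL : L \in unitmx by rewrite unitmxE detL unitr1.
have uV : V \in unitmx.
  rewrite -(mulKmx uL V) -[L *m V]/(L * V) -eqLV.
  by rewrite !unitmx_mul unitmx_inv uL unitmx_perm mx_unit.
have [l lE] := @mx_surj _ _ G _ uL; have [b bE] := @mx_surj _ _ G _ uV.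
set w := pm G (w0 m).
have -> : g = ((pm G s)^-1 * (w * (w^-1 * l * w) * w^-1) * b)%g.
  rewrite !mulgA !mulgK; apply: (mulgI (pm G s)); rewrite !mulgA mulgV mul1g.
  by apply: mx_inj; rewrite !mxM pm_mx lE bE.
have SV t : stab (pm G t)^-1%g by rewrite -pmV; apply: stab_perm.
apply: stabM (stabM (SV s) (stabM (stabM (@stab_perm _) _) (SV _))) _.
  apply: stab_borel; apply/conj_w0P => i j ltij; rewrite lE Ll ?(ltnW ltij) //.
  by rewrite -val_eqE /= ltn_eqF.
by apply: stab_borel; apply/borelP => i j ltji; rewrite bE Vu.
Qed.

Theorem Uspan_lattice x : Uspan (x * eps).
Proof.
rewrite [x]ga_sum_coef mulr_suml; apply: Uspan_sum => g _.
rewrite -scalerAl; apply/UspanZ/stab_all.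
by rewrite -[eps]mul1r -[1]/([g 1%g]); apply/Uspan_uni/group1.
Qed.

End UnipotentSpan.

(** * Combinatorics of permutations and triangular matrices *)

Section Combinatorics.
Variable m : nat.
Local Notation N := m.+1.
Implicit Types (s t : 'S_N) (i j k : 'I_N).

Lemma decreasing_w0 s :
  (forall i j, j = i.+1 :> nat -> (s j < s i)%N) -> s = w0 m.
Proof.
move=> decr; apply: perm_le_eq => i; rewrite permE /=.
have [d] := ubnP (m - i); elim: d i => // d IH i ltd.
case: (ltnP i m) => [ltim|]; last by have := ltn_ord i; lia.
have Ni : (i.+1 < N)%N by lia.
have /= := IH (Ordinal Ni); have := @decr i (Ordinal Ni) erefl; lia.
Qed.

Lemma rank_perm (key : 'I_N -> nat) : injective key ->
  exists s, forall i j, (s i < s j)%N = (key i < key j)%N.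
Proof.
move=> key_inj; pose below i := [set k | (key k < key i)%N]%SET.
have lt_below i j : (key i < key j)%N -> (#|below i| < #|below j|)%N.
  move=> ltij; apply/proper_card/properP; split.
    by apply/fintype.subsetP => k; rewrite !inE => /ltn_trans; apply.
  by exists i; rewrite !inE // ltnn.
have Nbelow i : (#|below i| < N)%N.
  rewrite -[X in (_ < X)%N]card_ord -cardsT; apply/proper_card/properP.
  by split; [apply/fintype.subsetP | exists i; rewrite !inE // ltnn].
pose f i := Ordinal (Nbelow i).
have f_lt i j : (f i < f j)%N = (key i < key j)%N.
  case: (ltngtP (key i) (key j)) => [/lt_below -> //|/lt_below lt|/key_inj->].
    by rewrite ltnNge (ltnW lt).
  by rewrite ltnn.
have f_inj : injective f.
  move=> i j eij; apply: key_inj.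
  by case: (ltngtP (key i) (key j)); rewrite // -f_lt eij ltnn.
by exists (perm f_inj) => i j; rewrite !permE f_lt.
Qed.

(** The permutation w0 w_J: cut the indices into the maximal intervals whose
    neighbours are linked by J, list these intervals in reverse order, each of
    them increasingly, and send every index to its position.  Simple roots in J
    go to simple roots, and the inverse permutation sends the remaining simple
    roots to negative roots; this is how the degenerate character of J appears
    as a conjugate of the nondegenerate one. *)
Lemma block_reversal (J : pred nat) : exists s : 'S_N,
  (forall i j, j = i.+1 :> nat -> J i -> s j = (s i).+1 :> nat) /\
  (forall i j, j = (i.+1) :> nat -> (s^-1%g i < s^-1%g j)%N ->
     s^-1%g j = (s^-1%g i).+1 :> nat /\ J (s^-1%g i)).
Proof.
(* blk i numbers the interval containing i; the key sorts by decreasing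
   interval first and by increasing index inside each interval. *)
pose blk (i : nat) := (\sum_(l < i) ~~ J l)%N.
have blkS (i : nat) : blk i.+1 = (blk i + ~~ J i)%N by rewrite /blk big_ord_recr.
have blk0 : blk 0%N = 0%N by rewrite /blk big_ord0.
have blk_le (i : nat) : (blk i <= i)%N.
  by elim: i => [|i IH]; [rewrite blk0 | rewrite blkS; case: (J i) => /=; lia].
have blk_mono (i j : nat) : (i <= j)%N -> (blk i <= blk j)%N.
  by move=> /subnKC <-; elim: (j - i)%N => [|d IH]; rewrite ?addn0 // addnS blkS; lia.
pose key (i : 'I_N) := ((N - blk i) * N + i)%N.
have key_lt (i j : 'I_N) : (i < j)%N -> (key i < key j)%N = (blk i == blk j).
  move=> ltij; rewrite /key; have := blk_mono _ _ (ltnW ltij).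
  have := blk_le j; have := ltn_ord j; case: eqP => [->|]; first by lia.
  move=> nb Nj bj bij; apply/negbTE; rewrite -leqNgt.
  have : ((N - blk j).+1 * N <= (N - blk i) * N)%N by rewrite leq_mul2r; lia.
  by rewrite mulSn; lia.
have key_inj : injective key.
  move=> i j; rewrite /key => e; apply: val_inj => /=.
  have := congr1 (modn^~ N) e; rewrite /= !modnMDl !modn_small //; exact: ltn_ord.
have [s sP] := rank_perm key_inj; exists s; split.
  move=> i j ji Ji; have ltij : (i < j)%N by rewrite ji.
  have keyj : key j = (key i).+1 by rewrite /key ji blkS Ji addn0 addnS.
  have ltsij : (s i < s j)%N by rewrite sP keyj.
  have Nsi : ((s i).+1 < N)%N by apply: leq_ltn_trans ltsij (ltn_ord _).
  pose k := s^-1%g (Ordinal Nsi).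
  have sk : s k = (s i).+1 :> nat by rewrite permKV.
  have := sP i k; have := sP j k; rewrite sk ltnSn keyj => + /esym ltik.
  rewrite ltnNge ltsij /= => /esym/negbT; rewrite -leqNgt => lekj.
  by have /key_inj <- : key k = key j by rewrite keyj; lia.
move=> i j ji; set x := s^-1%g i; set y := s^-1%g j => ltxy.
have sx : s x = i by rewrite permKV.
have sy : s y = j by rewrite permKV.
have kxy : (key x < key y)%N by rewrite -sP sx sy ji.
have bxy : blk x == blk y by rewrite -key_lt.
have Nx : (x.+1 < N)%N by apply: leq_ltn_trans ltxy (ltn_ord _).
pose z := Ordinal Nx.
have bxz : blk x = blk z.
  apply/eqP; rewrite eqn_leq blk_mono //= (eqP bxy) blk_mono //.
have Jx : J x by move: bxz; rewrite /= blkS; case: (J x) => //; lia.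
split=> //; case: (ltngtP y z) => [| ltzy |-> //]; first by rewrite /=; lia.
have : (key x < key z)%N by rewrite key_lt ?bxz //=.
have : (key z < key y)%N by rewrite key_lt // -bxz.
by rewrite -!sP sx sy ji ltnS => lt1 lt2; move: (leq_trans lt2 lt1); rewrite ltnn.
Qed.

End Combinatorics.

(** If y is unitriangular for the order given by t and y = l a is an LU
    decomposition, then the uniqueness of this decomposition forces a to be
    unitriangular for both orders.  The proof follows the algorithm, one row of
    a and one column of l at a time. *)
Lemma lu_support (F : fieldType) (N : nat) (l a y : 'M[F]_N) (t : 'I_N -> nat) :
  injective t -> y = l *m a ->
  (forall i j : 'I_N, (i < j)%N -> l i j = 0) ->
  (forall i j : 'I_N, (j <= i)%N -> a i j = (i == j)%:R) ->
  (forall i j, (t j <= t i)%N -> y i j = (i == j)%:R) ->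
  forall i j : 'I_N, (i < j)%N -> (t j < t i)%N -> a i j = 0.
Proof.
move=> t_inj yla l0 a0 y0.
suff H : forall d (i : 'I_N), (i < d)%N ->
   (forall j : 'I_N, (i < j)%N -> (t j < t i)%N -> a i j = 0) /\
   (forall r : 'I_N, (i < r)%N -> (t i < t r)%N -> l r i = 0).
  by move=> i; have [] := H i.+1 i (ltnSn i).
elim=> // d IH i ltid.
have yE (x j : 'I_N) : (i <= x)%N -> (i <= j)%N -> (t j <= t x)%N -> (t j <= t i)%N ->
    (t i <= t x)%N -> y x j = l x i * a i j + \sum_(k : 'I_N | (i < k)%N) l x k * a k j.
  move=> leix leij tjx tji tix; rewrite yla mxE (bigD1 i) //=; congr (_ + _).
  rewrite (bigID (fun k : 'I_N => (i < k)%N)) /= [X in _ + X]big1 ?addr0.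
    by apply: eq_bigl => k; case: (ltnP i k) => [lt|];
      rewrite ?andbF ?andbT // -val_eqE /= gtn_eqF.
  move=> k /andP[nki]; rewrite -leqNgt => leki.
  have ltki : (k < i)%N by rewrite ltn_neqAle leki andbT.
  have [a0k l0k] := IH k (leq_trans ltki ltid).
  case: (ltngtP (t k) (t i)) => [lt|gt|/t_inj eki]; last by rewrite eki eqxx in nki.
    by rewrite l0k ?mul0r ?(leq_trans ltki) // (leq_trans lt).
  by rewrite a0k ?mulr0 ?(leq_trans ltki) // (leq_ltn_trans tji).
have lii : l i i = 1.
  have := yE i i (leqnn _) (leqnn _) (leqnn _) (leqnn _) (leqnn _).
  rewrite y0 // a0 // eqxx mulr1 big1 ?addr0 // => k ltik.
  by rewrite l0 // mul0r.
split=> [j ltij ltji | r ltir lttir].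
  have := yE i j (leqnn _) (ltnW ltij) (ltnW ltji) (ltnW ltji) (leqnn _).
  rewrite y0 ?(ltnW ltji) // lii mul1r big1 ?addr0 => [<-|k ltik].
    by rewrite -val_eqE /= ltn_eqF.
  by rewrite l0 // mul0r.
have := yE r i (ltnW ltir) (leqnn _) (ltnW lttir) (leqnn _) (ltnW lttir).
rewrite y0 ?(ltnW lttir) // a0 // eqxx mulr1 big1 ?addr0 => [<-|k ltik].
  by rewrite -val_eqE /= gtn_eqF.
by rewrite a0 1?ltnW // -val_eqE /= gtn_eqF // mulr0.
Qed.

(** * Whittaker vectors *)

Section AdditiveCharacter.
Variables (F : finFieldType) (R : idomainType) (psi : F -> R).

Definition nontrivial_add_char := [/\ psi 0 = 1,
  {morph psi : a b / a + b >-> a * b} & exists a, psi a != 1].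

(** Translating t by b / a with psi b != 1 multiplies the sum by psi b. *)
Lemma sum_add_char a : nontrivial_add_char ->
  \sum_t psi (t * a) = if a == 0 then #|F|%:R else 0.
Proof.
case=> psi0 psiD [b psib]; case: eqVneq => [->|a0].
  by under eq_bigr do rewrite mulr0 psi0; rewrite sumr_const.
apply/eqP; set S := \sum_t _.
have : S = psi b * S.
  rewrite mulr_sumr /S (reindex_inj (addrI (b / a))) /=.
  by apply: eq_bigr => t _; rewrite mulrDl divfK // psiD.
by move/eqP; rewrite -subr_eq0 -{1}[S]mul1r -mulrBl mulf_eq0 subr_eq0 eq_sym (negPf psib).
Qed.

End AdditiveCharacter.

Section Whittaker.
Variables (F : finFieldType) (m : nat) (G : gl_group F m) (R : idomainType).
Variables (psi : F -> R) (psiP : nontrivial_add_char psi).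
Local Notation N := m.+1.
Local Notation B := (bor G).
Local Notation U := (uni G).
Local Notation RG := (group_algebra R G).
Local Notation eps := (eps G R).
Local Notation "[ 'g' x ]" := (ga_elt R x) (format "[ 'g'  x ]").
Implicit Types (g h u v : G) (s t : 'S_N) (i j k : 'I_N) (x y : RG) (J : pred nat).

Let psi0 : psi 0 = 1. Proof. by case: psiP. Qed.
Let psiD a b : psi (a + b) = psi a * psi b. Proof. by case: psiP. Qed.

(** The characters of U trivial on its commutator subgroup are given by the
    entries just above the diagonal; J lists the simple roots on which the
    character is nontrivial. *)
Definition superdiag J (A : 'M[F]_N) : F :=
  \sum_(p : 'I_N * 'I_N | J p.1 && (p.2 == p.1.+1 :> nat)) A p.1 p.2.

Definition uchar J u : R := psi (superdiag J (mx u)).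

(** Up to a scalar, the idempotent of the linear character inverse to
    [uchar J]; [whit predT * eps] is the Gelfand-Graev (Whittaker) vector. *)
Definition whit J : RG := wsum U (uchar J).

Lemma uchar1 J : uchar J (1%g : G) = 1.
Proof.
rewrite /uchar /superdiag big1 // => -[i j] /= /andP[_ /eqP ji].
by rewrite mx1 mxE -val_eqE /= ji ltn_eqF.
Qed.

Lemma ucharM J u v : u \in U -> v \in U -> uchar J (u * v)%g = uchar J u * uchar J v.
Proof.
move=> Uu Uv; rewrite -psiD; congr (psi _).
rewrite -big_split; apply: eq_bigr => -[i j] /= /andP[_ /eqP ji].
have vjj := uni_diag j Uv; have uii := uni_diag i Uu.
move/uniP: Uu => Uu; move/uniP: Uv => Uv.
have ltij : (i < j)%N by rewrite ji.
have nij : i != j by rewrite -val_eqE /= ltn_eqF.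
rewrite mxM mxE (bigD1 i) //= (bigD1 j) 1?eq_sym //= big1 ?addr0 => [|k].
  by rewrite vjj uii mul1r mulr1 addrC.
move=> /andP[nki nkj]; case: (leqP k i) => [leki|ltik].
  by rewrite Uu // eq_sym (negPf nki) mul0r.
have ltjk : (j < k)%N by rewrite ltn_neqAle ji ltik andbT -ji eq_sym val_eqE.
rewrite Uv ?(ltnW ltjk) // (negPf nkj) mulr0 //.
Qed.

Lemma ucharV J u : u \in U -> uchar J u^-1%g * uchar J u = 1.
Proof. by move=> Uu; rewrite -ucharM ?groupV // mulVg uchar1. Qed.

Lemma uchar_elem J i j a : j = i.+1 :> nat -> J i -> uchar J (elem G i j a) = psi a.
Proof.
move=> ji Ji; congr (psi _); have ltij : (i < j)%N by rewrite ji.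
rewrite /superdiag elemE // (bigD1 (i, j)) /= ?Ji ?ji //= big1 ?addr0.
  rewrite !mxE !eqxx mulr1 -val_eqE /= ji ltn_eqF ?add0r //.
move=> [x y] /= /andP[/andP[_ /eqP yx] nxy]; rewrite !mxE.
rewrite -[x == y]val_eqE /= yx ltn_eqF ?add0r // -xpair_eqE (negPf nxy) mulr0 //.
Qed.

Lemma whit_mulr J v : v \in U -> whit J * [g v] = uchar J v^-1%g *: whit J.
Proof.
move=> Uv; rewrite /whit /wsum mulr_suml scaler_sumr.
rewrite (reindex_inj (mulIg v^-1)%g) /=.
apply: eq_big => u; first by rewrite groupMr ?groupV.
rewrite groupMr ?groupV // => Uu.
by rewrite -scalerAl -ga_eltM mulgKV scalerA ucharM ?groupV // mulrC.
Qed.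

(** As the lattice is RU eps, its part of type J has rank at most one. *)
Lemma whit_rank1 J x : exists c : R, whit J * (x * eps) = c *: (whit J * eps).
Proof.
have [c ->] := Uspan_lattice x.
exists (\sum_(u in U) c u * uchar J u^-1%g).
rewrite {1}/wsum [X in _ * X]mulr_suml mulr_sumr scaler_suml; apply: eq_bigr => u Uu.
by rewrite -scalerAl ga_scaleAr mulrA whit_mulr // -scalerAl scalerA.
Qed.

(** If s is not w0 then s i < s j for some adjacent i < j; the root subgroup
    of (i, j) fixes the coset sB, while psi is nontrivial on it. *)
Lemma whit_flag s : s != w0 m -> whit predT * flag R (pm G s) = 0.
Proof.
move=> nsw0; have [i [j [ji ltsij]]] : exists i j, j = i.+1 :> nat /\ (s i < s j)%N.
  apply: contrapT => H; move/eqP: nsw0; apply; apply: decreasing_w0 => i j ji.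
  rewrite ltnNge; apply/negP => le; apply: H; exists i, j; split=> //.
  by rewrite ltn_neqAle le andbT val_eqE (inj_eq perm_inj) -val_eqE /= ji ltn_eqF.
have ltij : (i < j)%N by rewrite ji.
have [a psia] : exists a, psi a != 1 by case: psiP.
set z := whit predT * _.
have zE : z = psi a *: z.
  rewrite {1}/z -(elem_flag G R (- a) ltij ltsij) -elt_flag mulrA.
  by rewrite whit_mulr ?elem_uni // -elemV // opprK uchar_elem // -scalerAl.
apply: ga_coefP => g; rewrite ga_coef0; apply/eqP.
have /eqP := congr1 (fun x : RG => ga_coef x g) zE; rewrite ga_coefZ.
rewrite -subr_eq0 -{1}[ga_coef z g]mul1r -mulrBl mulf_eq0 subr_eq0 eq_sym.
by rewrite (negPf psia).
Qed.

Lemma whit_eps :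
  whit predT * eps = (-1) ^+ odd_perm (w0 m) *: (whit predT * flag R (pm G (w0 m))).
Proof.
rewrite {1}/eps mulr_sumr (bigD1 (w0 m)) //= big1 ?addr0 => [|s ns].
  by rewrite ga_scaleAr.
by rewrite ga_scaleAr whit_flag // scaler0.
Qed.

End Whittaker.

(** * From a nondegenerate Whittaker vector to the degenerate ones *)

Section DegenerateWhittaker.
Variables (F : finFieldType) (m : nat) (G : gl_group F m) (R : idomainType).
Variables (psi : F -> R) (psiP : nontrivial_add_char psi).
Local Notation N := m.+1.
Local Notation B := (bor G).
Local Notation U := (uni G).
Local Notation RG := (group_algebra R G).
Local Notation eps := (eps G R).
Local Notation "[ 'g' x ]" := (ga_elt R x) (format "[ 'g'  x ]").
Local Notation uchar := (uchar psi).
Local Notation whit := (whit G psi).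
Local Notation q := #|F|.
Implicit Types (g h u v : G) (s t : 'S_N) (i j : 'I_N) (x y : RG) (J : pred nat).

Let psi0 : psi 0 = 1. Proof. by case: psiP. Qed.

(** The (u, a) contributing to the coefficient computed in [whit_pm_coef] are
    those for which s^-1 u s a^-1 is lower triangular; then a belongs to
    s^-1 U s by uniqueness of the LU decomposition. *)
Lemma conj_uni_w0 s u a : u \in U -> a \in U ->
  ((pm G (w0 m))^-1 * ((pm G s)^-1 * u * pm G s * a^-1) * pm G (w0 m))%g \in B ->
  a \in pattern G (fun i j => (i < j)%N && (s^-1%g i < s^-1%g j)%N).
Proof.
move=> Uu Ua /conj_w0P low.
have t_inj : injective (fun i => s^-1%g i : nat).
  by move=> i j /val_inj/perm_inj.
have yE : mx ((pm G s)^-1 * u * pm G s)%g =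
    mx ((pm G s)^-1 * u * pm G s * a^-1)%g *m mx a by rewrite -mxM mulgKV.
apply/patternP => i j; case: (ltnP i j) => [ltij|leji _]; last first.
  by move/uniP: Ua => ->.
rewrite -leqNgt leq_eqVlt (inj_eq t_inj) => /predU1P[eij|ltt].
  by rewrite eij ltnn in ltij.
rewrite -val_eqE /= ltn_eqF //; move/uniP: Ua => Ua.
apply: (lu_support t_inj yE low Ua _ ltij ltt) => {ltij ltt}{}i {}j le.
rewrite -{1}(permKV s i) -{1}(permKV s j) conj_pm.
by move/uniP: Uu => -> //; rewrite (inj_eq perm_inj).
Qed.

(** The two properties of [block_reversal] mean that conjugation by s identifies
    the nondegenerate character with that of J on U intersected with s^-1 U s. *)
Lemma conj_uchar J s a :
  (forall i j, j = i.+1 :> nat -> J i -> s j = (s i).+1 :> nat) ->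
  (forall i j, j = i.+1 :> nat -> (s^-1%g i < s^-1%g j)%N ->
     s^-1%g j = (s^-1%g i).+1 :> nat /\ J (s^-1%g i)) ->
  a \in pattern G (fun i j => (i < j)%N && (s^-1%g i < s^-1%g j)%N) ->
  uchar J (pm G s * a * (pm G s)^-1)%g = uchar predT a.
Proof.
move=> sJ sVJ /patternP Pa; congr (psi _); rewrite /superdiag.
have sE i j : mx (pm G s * a * (pm G s)^-1)%g i j = mx a (s i) (s j).
  by rewrite -pmV -{1}(permK s j) mul_mx_pm mul_pm.
under eq_bigr do rewrite sE.
pose f (p : 'I_N * 'I_N) := (s^-1%g p.1, s^-1%g p.2).
pose f' (p : 'I_N * 'I_N) := (s p.1, s p.2).
have fK : cancel f f' by case=> i j; rewrite /f /f' /= !permKV.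
have f_inj : injective f := can_inj fK.
rewrite (reindex_inj f_inj) /= big_mkcond [RHS]big_mkcond /=.
apply: eq_bigr => -[i j] _ /=; rewrite !permKV.
case: ifP => [/andP[Ji /eqP ji]|nJ].
  by have := sJ _ _ ji Ji; rewrite !permKV => ->; rewrite eqxx.
case: eqP => // ji; rewrite Pa; first by rewrite -val_eqE /= ji ltn_eqF.
rewrite ji ltnSn /=; apply/negP => lt; have [e Ji] := sVJ _ _ ji lt.
by rewrite e Ji eqxx in nJ.
Qed.

Lemma conj_uni_low J s u :
  (forall i j, j = i.+1 :> nat -> J i -> s j = (s i).+1 :> nat) -> u \in U ->
  ((pm G (w0 m))^-1 * ((pm G s)^-1 * u * pm G s) * pm G (w0 m))%g \in B ->
  uchar J u = 1.
Proof.
move=> sJ Uu /conj_w0P low; rewrite /uchar /superdiag big1 // => -[i j] /=.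
case/andP=> Ji /eqP ji; rewrite -(conj_pm s s u) low //.
by rewrite (sJ i j).
Qed.

Lemma in_low_pattern s u : u \in U ->
  (((pm G (w0 m))^-1 * ((pm G s)^-1 * u * pm G s) * pm G (w0 m))%g \in B) =
  (u \in pattern G (fun i j => (i < j)%N && (s j < s i)%N)).
Proof.
move=> /uniP Uu; apply/conj_w0P/patternP => [low i j|Pu i j ltij].
  case: (ltnP i j) => [ltij|leji _]; last by rewrite Uu.
  rewrite -leqNgt leq_eqVlt val_eqE (inj_eq perm_inj) => /predU1P[eij|lt].
    by rewrite eij ltnn in ltij.
  by rewrite -(conj_pm s s u) low // -val_eqE /= ltn_eqF.
rewrite -(permKV s i) -(permKV s j) conj_pm Pu; last first.
  by rewrite !permKV negb_and -!leqNgt (ltnW ltij) orbT.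
by rewrite (inj_eq perm_inj) -val_eqE /= ltn_eqF.
Qed.

(** The coefficient is a sum over u and a of characters.  By [conj_uni_w0] only
    the a with s a s^-1 in U matter, and after u is replaced by u (s a s^-1)
    all the nonzero terms are 1; they are counted by two pattern groups. *)
Lemma whit_pm_coef J s :
  (forall i j, j = i.+1 :> nat -> J i -> s j = (s i).+1 :> nat) ->
  (forall i j, j = i.+1 :> nat -> (s^-1%g i < s^-1%g j)%N ->
     s^-1%g j = (s^-1%g i).+1 :> nat /\ J (s^-1%g i)) ->
  exists k, ga_coef (whit J * ([g pm G s] * (whit predT * flag R (pm G (w0 m)))))
    (pm G s * pm G (w0 m))%g = (q ^ k)%:R.
Proof.
move=> sJ sVJ; set w := pm G s; set w' := pm G (w0 m).
pose low g := (w'^-1 * g * w' \in B)%g.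
pose A := pattern G (fun i j => (i < j)%N && (s^-1%g i < s^-1%g j)%N).
pose D := pattern G (fun i j => (i < j)%N && (s j < s i)%N).
have AU : A \subset U by apply: pattern_uni => i j /andP[].
have DU : D \subset U by apply: pattern_uni => i j /andP[].
have -> : ga_coef (whit J * ([g w] * (whit predT * flag R w'))) (w * w')%g =
    \sum_(a in U) \sum_(u in U)
       uchar J u * uchar predT a^-1%g * (low (w^-1 * u * w * a^-1)%g)%:R.
  rewrite /whit /wsum [X in _ * (_ * X)]mulr_suml [X in _ * X]mulr_sumr mulr_sumr.
  rewrite ga_coef_sum (reindex_inj (@invg_inj _)) /=.
  apply: eq_big => [a|a]; rewrite groupV // => Ua.
  rewrite mulr_suml ga_coef_sum; apply: eq_bigr => u Uu.
  rewrite -!scalerAl !ga_scaleAr !elt_flag !ga_coefZ mulrA ga_coef_flag.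
  congr (_ * _%:R); rewrite -groupV /low; apply: (congr1 (fun z => (z \in B) : nat)).
  by rewrite !invMg !invgK !mulgA.
have sumA a : a \in A -> \sum_(u in U)
    uchar J u * uchar predT a^-1%g * (low (w^-1 * u * w * a^-1)%g)%:R = #|D|%:R.
  move=> Aa; have Ua := fintype.subsetP AU a Aa.
  have Uwa : (w * a * w^-1)%g \in U.
    apply/uniP => i j leji; rewrite -pmV -{1}(permK s j) mul_mx_pm mul_pm.
    move/patternP: Aa => ->; first by rewrite (inj_eq perm_inj).
    by rewrite !permK negb_and -!leqNgt leji orbT.
  rewrite (reindex_inj (mulIg (w * a * w^-1)%g)) /=.
  rewrite -sumr_const big_mkcond [RHS]big_mkcond /=; apply: eq_bigr => u _.
  rewrite groupMr //; case: ifP => Uu; last first.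
    by case: ifP => // /(fintype.subsetP DU); rewrite Uu.
  rewrite ucharM // conj_uchar // -(mulrA (uchar J u)).
  rewrite [uchar predT a * _]mulrC ucharV // mulr1.
  have -> : (w^-1 * (u * (w * a * w^-1)) * w * a^-1 = w^-1 * u * w)%g.
    by rewrite !mulgA mulgKV mulgK.
  rewrite /low in_low_pattern //; case: ifP => Du; last by rewrite mulr0.
  by rewrite (conj_uni_low sJ) ?in_low_pattern // mulr1.
have -> : \sum_(a in U) \sum_(u in U)
    uchar J u * uchar predT a^-1%g * (low (w^-1 * u * w * a^-1)%g)%:R
  = \sum_(a in A) #|D|%:R :> R.
  rewrite (bigID (mem A)) /= [X in _ + X]big1 ?addr0 => [|a /andP[Ua nAa]].
    rewrite big_mkcond [RHS]big_mkcond /=; apply: eq_bigr => a _.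
    case: (boolP (a \in A)) => Aa; last by rewrite andbF.
    by rewrite (fintype.subsetP AU) // sumA.
  apply: big1 => u Uu; case: (boolP (low _)) => [lw|]; last by rewrite mulr0.
  by case/negP: nAa; apply: conj_uni_w0 lw.
rewrite sumr_const.
have [a ->] : exists a, #|A| = (q ^ a)%N.
  by eexists; apply: card_pattern => i j /andP[].
have [d ->] : exists d, #|D| = (q ^ d)%N.
  by eexists; apply: card_pattern => i j /andP[].
by exists (d + a)%N; rewrite expnD natrM mulr_natr.
Qed.

(** The left submodule generated by the Whittaker vector, saturated with respect
    to q, so that one can divide by q as if it were invertible in R. *)
Definition whit_sat x := exists k a, (q ^ k)%:R *: x = a * (whit predT * eps).

Lemma whit_satD x y : whit_sat x -> whit_sat y -> whit_sat (x + y).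
Proof.
move=> [k [a ea]] [l [b eb]].
exists (k + l)%N, ((q ^ l)%:R *: a + (q ^ k)%:R *: b).
rewrite mulrDl -!scalerAl -ea -eb !scalerA -!natrM -!expnD scalerDr.
by rewrite [(l + k)%N]addnC.
Qed.

Lemma whit_satM z x : whit_sat x -> whit_sat (z * x).
Proof. by move=> [k [a ea]]; exists k, (z * a); rewrite -mulrA -ea ga_scaleAr. Qed.

Lemma whit_sat0 : whit_sat 0.
Proof. by exists 0%N, 0; rewrite mul0r scaler0. Qed.

Lemma whit_sat_sum I (r : seq I) (P : pred I) (X : I -> RG) :
  (forall z, P z -> whit_sat (X z)) -> whit_sat (\sum_(z <- r | P z) X z).
Proof.
move=> WX; apply: big_rec => [|z x /WX]; [exact: whit_sat0 | exact: whit_satD].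
Qed.

Lemma whit_satZ (c : R) x : whit_sat x -> whit_sat (c *: x).
Proof.
by move=> Wx; rewrite -[x]mul1r scalerAl; apply: whit_satM.
Qed.

Lemma whit_sat_div k x : whit_sat ((q ^ k)%:R *: x) -> whit_sat x.
Proof.
move=> [l [a ea]]; exists (l + k)%N, a.
by rewrite -ea scalerA -natrM -expnD.
Qed.

Lemma whit_sat_gen : whit_sat (whit predT * eps).
Proof. by exists 0%N, 1; rewrite scale1r mul1r. Qed.

(** whit J s (whit predT eps) is a multiple c of whit J eps by [whit_rank1], and
    the coefficient just computed shows that c divides a power of q. *)
Lemma whit_sat_degenerate J : whit_sat (whit J * eps).
Proof.
have [s [sJ sVJ]] := block_reversal m J.
have [k ek] := whit_pm_coef sJ sVJ.
have [c ec] := whit_rank1 psiP J ([g pm G s] * whit predT).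
set g0 := (pm G s * pm G (w0 m))%g in ek.
pose y := ga_coef (whit J * eps) g0.
have ecy : c * y = (-1) ^+ odd_perm (w0 m) * (q ^ k)%:R.
  rewrite -ga_coefZ -ec -ek -ga_coefZ; congr (ga_coef _ _).
  by rewrite -mulrA (whit_eps _ psiP) !ga_scaleAr.
apply: (@whit_sat_div k).
have -> : (q ^ k)%:R = ((-1) ^+ odd_perm (w0 m) * y) * c :> R.
  by rewrite -mulrA [y * c]mulrC ecy mulrA -signr_addb addbb mul1r.
rewrite -scalerA -ec; apply/whit_satZ/whit_satM; rewrite -mulrA.
exact/whit_satM/whit_sat_gen.
Qed.

End DegenerateWhittaker.

(** * The Whittaker vector generates the lattice *)

Section ParabolicInduction.
Variables (F : finFieldType) (m : nat) (G : gl_group F m) (R : idomainType).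
Variables (psi : F -> R) (psiP : nontrivial_add_char psi).
Local Notation N := m.+1.
Local Notation B := (bor G).
Local Notation U := (uni G).
Local Notation RG := (group_algebra R G).
Local Notation eps := (eps G R).
Local Notation "[ 'g' x ]" := (ga_elt R x) (format "[ 'g'  x ]").
Local Notation uchar := (uchar psi).
Local Notation whit := (whit G psi).
Local Notation whit_sat := (@whit_sat _ _ G _ psi).
Local Notation q := #|F|.
Implicit Types (g h u v : G) (i j : 'I_N) (x y : RG) (J : pred nat).

Let psi0 : psi 0 = 1. Proof. by case: psiP. Qed.
Let psiD : {morph psi : a b / a + b >-> a * b}. Proof. by case: psiP. Qed.

(** The unipotent matrices whose only nontrivial columns are those of index
    larger than k: the group shrinks from U to 1 as k goes from 0 to m. *)
Definition colgrp (k : nat) : {set G} := pattern G (fun i j => (i < j)%N && (k < j)%N).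

Definition colwhit (k : nat) J : RG := wsum (colgrp k) (uchar J).

Lemma colgrp0 : colgrp 0 = U.
Proof.
apply/setP => u; rewrite /uni; apply/patternP/patternP => H i j n; apply: H.
  by apply: contra n => /andP[].
by apply: contra n => ltij; rewrite ltij (leq_ltn_trans _ ltij).
Qed.

Lemma colgrp_last : colgrp m = [set 1%g]%SET.
Proof.
apply/setP => u; apply/patternP/finset.set1P => [H | -> i j _].
  apply: mx_inj; apply/matrixP => i j; rewrite mx1 mxE H // [(m < j)%N]ltnNge.
  by rewrite -(ltnS j m) ltn_ord andbF.
by rewrite mx1 mxE.
Qed.

Section Step.
Variables (k : nat) (r c : 'I_N).
Variables (rk : r = k :> nat) (ck : c = k.+1 :> nat).

(** The elements of GL_{k+1}, embedded in the upper left corner, normalize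
    [colgrp k].  Their conjugation acts linearly on the part of column c = k + 1
    above the diagonal and fixes the rows below. *)
Lemma conj_colgrp g u :
  (forall i j, (k < i)%N || (k < j)%N -> mx g i j = (i == j)%:R) ->
  u \in colgrp k ->
  [/\ (g * u * g^-1)%g \in colgrp k,
      (forall i j, (k < i)%N -> mx (g * u * g^-1)%g i j = mx u i j) &
      mx (g * u * g^-1)%g r c = \sum_(i : 'I_N | (i < c)%N) mx g r i * mx u i c].
Proof.
move=> gblock /patternP Uu; set v := (g * u * g^-1)%g; set X := mx u - 1%:M.
have uX : mx u = 1%:M + X by rewrite addrC subrK.
have X0 i j : ~~ ((i < j)%N && (k < j)%N) -> X i j = 0.
  by move=> nij; rewrite !mxE Uu // subrr.
have Xg : X *m mx g = X.
  apply/matrixP => i j; rewrite mxE (bigD1 j) //= big1 => [|l nlj].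
    case: (ltnP k j) => [ltkj|lejk].
      by rewrite gblock ?ltkj ?orbT // eqxx mulr1 addr0.
    by rewrite X0 ?mul0r ?addr0 // [(k < j)%N]ltnNge lejk andbF.
  case: (ltnP k l) => [ltkl|lelk]; last by rewrite X0 ?mul0r // [(k < l)%N]ltnNge lelk andbF.
  by rewrite gblock ?ltkl // (negPf nlj) mulr0.
have vE : mx v = 1%:M + mx g *m X.
  apply: (can_inj (mulmxK (mx_unit g))); rewrite -mxM mulgKV mulmxDl mul1mx.
  by rewrite -mulmxA Xg mxM uX mulmxDr mulmx1.
have vlow i j : (k < i)%N -> mx v i j = mx u i j.
  move=> ltki; rewrite vE uX [LHS]mxE [RHS]mxE; congr (_ + _).
  rewrite mxE (bigD1 i) //= big1 ?addr0 => [|l nli].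
    by rewrite gblock ?ltki // eqxx mul1r.
  by rewrite gblock ?ltki // eq_sym (negPf nli) mul0r.
split=> //.
  apply/patternP => i j nij; case: (ltnP k i) => [ltki|leik].
    by rewrite vlow // Uu.
  rewrite vE [LHS]mxE mxE mxE big1 ?addr0 // => l _.
  rewrite X0 ?mulr0 //; apply: contra nij => /andP[_ ltkj].
  by rewrite ltkj (leq_ltn_trans leik).
rewrite vE [LHS]mxE mxE -val_eqE /= rk ck ltn_eqF // add0r mxE.
rewrite (bigID (fun i : 'I_N => (i < c)%N)) /= [X in _ + X]big1 ?addr0.
  rewrite -ck; apply: eq_bigr => i ltic; rewrite !mxE -val_eqE /= ltn_eqF // subr0 //.
by move=> i nic; rewrite X0 ?mulr0 // negb_and nic.
Qed.

(** The characters of [colgrp k] that agree with [uchar J] outside column c and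
    are arbitrary on that column.  Letting a run over all of F^N, and not only
    over the coordinates before c, makes the sum over a a plain product. *)
Definition colchar (a : {ffun 'I_N -> F}) J u : R :=
  psi (\sum_(i : 'I_N) a i * (if (i < c)%N then mx u i c else 0)) * uchar J u.

(** The witness is the rank one perturbation 1 + x (a - e_r), where the column
    vector x satisfies x_r = 1, which gives the required row, and a x != 0,
    which makes the matrix invertible. *)
Lemma row_completion (a : {ffun 'I_N -> F}) i0 : (i0 < c)%N -> a i0 != 0 ->
  exists g, (forall i j, (k < i)%N || (k < j)%N -> mx g i j = (i == j)%:R) /\
    (forall i, (i < c)%N -> mx g r i = a i).
Proof.
move=> lti0 ai0.
pose A : 'rV[F]_N := \row_j (if (j < c)%N then a j else 0).
have ltrc : (r < c)%N by rewrite rk ck.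
have [x [xr xc dn0]] : exists x : 'cV[F]_N,
    [/\ x r 0 = 1, (forall i, (k < i)%N -> x i 0 = 0) & (A *m x) 0 0 != 0].
  have delta_c i : (i < c)%N -> forall j, (k < j)%N -> (delta_mx i 0 : 'cV[F]_N) j 0 = 0.
    move=> ltic j ltkj; rewrite mxE -val_eqE /= gtn_eqF //.
    by rewrite (leq_trans ltic) // ck.
  have Ad i : (i < c)%N -> (A *m delta_mx i 0 : 'M_1) 0 0 = a i.
    by move=> ltic; rewrite -colE !mxE ltic.
  case: (eqVneq (a r) 0) => [ar0|]; last first.
    by exists (delta_mx r 0); rewrite Ad //; split=> //; [rewrite mxE !eqxx | exact: delta_c].
  exists (delta_mx r 0 + delta_mx i0 0); split.
  - rewrite !mxE !eqxx; case: eqVneq => [e|_]; last by rewrite addr0.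
    by rewrite -e ar0 eqxx in ai0.
  - by move=> i ltki; rewrite mxE !delta_c ?addr0.
  - by rewrite mulmxDr mxE !Ad // ar0 add0r.
pose b := A - delta_mx 0 r.
pose d := (A *m x) 0 0.
have bx : b *m x = (d - 1)%:M.
  rewrite mulmxBl [A *m x]mx11_scalar -rowE -/d; apply/rowP => i.
  by rewrite !ord1 !mxE xr eqxx.
have gunit : 1%:M + x *m b \in unitmx.
  have PP : (x *m b) *m (x *m b) = (d - 1) *: (x *m b).
    by rewrite -mulmxA [b *m _]mulmxA bx mul_scalar_mx -scalemxAr.
  move: (x *m b) PP => P PP.
  suff : (1%:M + P) *m (1%:M - d^-1 *: P) = 1%:M by case/mulmx1_unit.
  rewrite mulmxDl mul1mx mulmxBr mulmx1 -scalemxAr PP scalerA mulrBr mulVf // mulr1.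
  by rewrite scalerBl scale1r opprB [P + _]addrC subrK subrK.
have [g gE] := @mx_surj _ _ G _ gunit; exists g; split=> [i j ltk|i ltic].
  rewrite gE [LHS]mxE mxE [(x *m b) i j]mxE big_ord1.
  case/orP: ltk => [lti|ltj]; first by rewrite xc // mul0r addr0.
  rewrite [b _ _]mxE !mxE ck ltnS leqNgt ltj /= -[j == r]val_eqE /= rk gtn_eqF //.
  by rewrite subr0 mulr0 addr0.
rewrite gE [LHS]mxE mxE [(x *m b) r i]mxE big_ord1 xr mul1r !mxE ltic eqxx /=.
by rewrite eq_sym addrC subrK.
Qed.

Definition above J : pred nat := fun d : nat => (k < d)%N && J d.
Definition upto J : pred nat := fun d : nat => (d == k) || above J d.

Lemma uchar_upto J u : uchar (upto J) u = psi (mx u r c) * uchar (above J) u.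
Proof.
rewrite -psiD; congr (psi _); rewrite /superdiag (bigD1 (r, c)) /=; last first.
  by rewrite /upto rk eqxx ck eqxx.
congr (_ + _); apply: eq_bigl => -[i j] /=; rewrite xpair_eqE -2!val_eqE /= rk ck.
rewrite /upto /above; case: (ltngtP i k) => [||->]; rewrite ?andbF ?andbT //.
by rewrite /= andbN.
Qed.

(** The row r of g turns the character given by a into the one given by the
    simple root (r, c); hence the characters that are nontrivial on column c and
    agree with [uchar J] on [colgrp k.+1] are conjugate to each other. *)
Lemma colwhit_conj g (a : {ffun 'I_N -> F}) J :
  (forall i j, (k < i)%N || (k < j)%N -> mx g i j = (i == j)%:R) ->
  (forall i, (i < c)%N -> mx g r i = a i) ->
  wsum (colgrp k) (colchar a (above J)) =
    [g g^-1%g] * (colwhit k (upto J) * [g g]).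
Proof.
move=> gblock ga; pose f u := (g * u * g^-1)%g.
have f_inj : injective f by move=> u v /mulIg/mulgI.
have fC : [set f u | u in colgrp k]%SET = colgrp k.
  apply/eqP; rewrite eqEcard card_imset // leqnn andbT.
  by apply/fintype.subsetP => _ /imsetP[u Cu ->]; case: (conj_colgrp gblock Cu).
rewrite /colwhit /wsum mulr_suml mulr_sumr -[in RHS]fC big_imset /=;
  last by move=> u v _ _ /f_inj.
apply: eq_bigr => u Cu; rewrite -scalerAl ga_scaleAr -!ga_eltM /f.
rewrite mulgKV mulKg; congr (_ *: _).
have [_ vlow vrc] := conj_colgrp gblock Cu.
rewrite uchar_upto vrc /colchar; congr (psi _ * psi _).
  rewrite [RHS]big_mkcond /=; apply: eq_bigr => i _.
  by case: ifP => [ltic|_]; rewrite ?mulr0 // ga.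
by apply: eq_bigr => -[i j] /= /andP[/andP[lti _] _]; rewrite vlow.
Qed.

Lemma colwhit_trivial (a : {ffun 'I_N -> F}) J :
  (forall i, (i < c)%N -> a i = 0) ->
  wsum (colgrp k) (colchar a (above J)) = colwhit k (above J).
Proof.
move=> a0; apply: eq_bigr => u _; congr (_ *: _).
rewrite /colchar big1 ?psi0 ?mul1r // => i _.
by case: ifP => [/a0->|_]; rewrite ?mul0r ?mulr0.
Qed.

Lemma sum_colchar J u : u \in colgrp k ->
  \sum_a colchar a (above J) u =
    if u \in colgrp k.+1 then (q ^ N)%:R * uchar J u else 0.
Proof.
move=> /patternP Cu; rewrite -mulr_suml.
under eq_bigr => a _ do rewrite (big_morph psi psiD psi0).
rewrite -(bigA_distr_bigA (fun i t => psi (t * (if (i < c)%N then mx u i c else 0)))).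
under eq_bigr => i _ do rewrite sum_add_char //.
case: ifP => [/patternP Cu'|/negP nCu].
  have uc i : (i < c)%N -> mx u i c = 0.
    move=> ltic; rewrite Cu' ?ck ?ltnn ?andbF //.
    by rewrite -val_eqE /= ltn_eqF // -ck.
  rewrite (eq_bigr (fun=> q%:R)) => [|i _]; last first.
    by case: (ltnP i c) => [ltic|_]; rewrite ?uc ?eqxx.
  rewrite prodr_const card_ord natrX; congr (_ * psi _).
  rewrite /superdiag big_mkcond [RHS]big_mkcond /=; apply: eq_bigr => -[i j] _ /=.
  rewrite /above; case: (ltnP k i) => //= leik; case: ifP => // /andP[_ /eqP ji].
  rewrite Cu'; first by rewrite -val_eqE /= ji ltn_eqF.
  by rewrite negb_and -!leqNgt [X in _ || X](_ : _ = true) ?orbT // ji ltnS.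
have [i ltic ui] : exists2 i : 'I_N, (i < c)%N & mx u i c != 0.
  apply: contrapT => H; apply: nCu; apply/patternP => i j nij.
  case: (boolP ((i < j)%N && (k < j)%N)) => [/andP[ltij ltkj]|]; last exact: Cu.
  have ejc : j = c.
    by apply: val_inj; move: nij; rewrite ltij /= ck; lia.
  rewrite ejc in ltij *; rewrite -[i == c]val_eqE /= ltn_eqF //.
  by apply: contrapT => /eqP ui; apply: H; exists i.
by rewrite (bigD1 i) //= ltic (negPf ui) !mul0r.
Qed.

(** Fourier inversion on column c. *)
Lemma colwhitS J :
  (q ^ N)%:R *: colwhit k.+1 J = \sum_a wsum (colgrp k) (colchar a (above J)).
Proof.
rewrite /wsum exchange_big /= /colwhit /wsum scaler_sumr.
rewrite big_mkcond [RHS]big_mkcond /=; apply: eq_bigr => u _.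
case: (boolP (u \in colgrp k)) => Cu.
  rewrite -scaler_suml sum_colchar //.
  by case: ifP => _; rewrite ?scale0r ?scalerA.
case: ifP => // Cu'; case/negP: Cu; move/patternP: Cu' => Cu'.
apply/patternP => i j n; apply: Cu'; apply: contra n => /andP[-> /ltnW] //.
Qed.

(** In the expansion [colwhitS] the characters trivial on column c and, by
    [colwhit_conj], the others as well, are instances of the hypothesis at k.
    This is why the statement quantifies over all J and over the whole
    lattice, which is stable under the conjugating element g. *)
Lemma colwhit_step :
  (forall J x, whit_sat (colwhit k J * (x * eps))) ->
  forall J x, whit_sat (colwhit k.+1 J * (x * eps)).
Proof.
move=> Wk J x; apply: (@whit_sat_div _ _ _ _ _ N).
rewrite scalerAl colwhitS mulr_suml; apply: whit_sat_sum => a _.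
have [[i0 lti0 ai0]|a0] := pselect (exists2 i0 : 'I_N, (i0 < c)%N & a i0 != 0).
  have [g [gblock ga]] := row_completion lti0 ai0.
  rewrite (colwhit_conj J gblock ga) -!mulrA; apply: whit_satM.
  by rewrite [_ * (x * _)]mulrA; apply: Wk.
rewrite colwhit_trivial // => i ltic; apply/eqP; apply: contrapT => /negP ai.
by apply: a0; exists i.
Qed.

End Step.

Theorem whit_sat_eps : whit_sat eps.
Proof.
have W0 J x : whit_sat (colwhit 0 J * (x * eps)).
  have -> : colwhit 0 J = whit J by rewrite /colwhit colgrp0.
  have [a ->] := whit_rank1 psiP J x.
  exact/whit_satZ/whit_sat_degenerate.
have W k : (k <= m)%N -> forall J x, whit_sat (colwhit k J * (x * eps)).
  elim: k => [|k IH] lekm //.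
  have ltkN : (k < N)%N := ltnW lekm.
  exact: (@colwhit_step k (Ordinal ltkN) (Ordinal (lekm : k.+1 < N)%N)) (IH (ltnW lekm)).
have := W m (leqnn m) pred0 1; rewrite /colwhit colgrp_last /wsum mul1r.
by rewrite big_set1 uchar1 // scale1r -[[g 1%g]]/(1 : RG) mul1r.
Qed.

End ParabolicInduction.

(** * The invariant form on Whittaker vectors *)

Section InvariantForm.
Variables (F : finFieldType) (m : nat) (G : gl_group F m) (R : idomainType).
Local Notation N := m.+1.
Local Notation B := (bor G).
Local Notation U := (uni G).
Local Notation RG := (group_algebra R G).
Local Notation eps := (eps G R).
Local Notation Bhat := (ga_sum R B).
Local Notation "[ 'g' x ]" := (ga_elt R x) (format "[ 'g'  x ]").
Local Notation q := #|F|.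
Implicit Types (g h u v : G) (s t : 'S_N) (i j : 'I_N) (x y z : RG).

Definition sgn_elt : RG := \sum_(s : 'S_N) (-1) ^+ odd_perm s *: [g pm G s].

Lemma epsE : eps = sgn_elt * Bhat.
Proof. by rewrite mulr_suml; apply: eq_bigr => s _; rewrite -scalerAl. Qed.

Lemma Bhat2 : Bhat * Bhat = #|B|%:R *: Bhat.
Proof.
rewrite {1}/ga_sum mulr_suml (eq_bigr (fun=> Bhat)) => [|b Bb].
  by rewrite sumr_const scaler_nat.
by rewrite -[LHS]/(flag R b) (@flagP _ _ _ _ _ 1%g) ?mulg1 ?groupV // /flag mul1r.
Qed.

Lemma ga_form_Bhat x y : ga_form (x * Bhat) y = ga_form x (y * Bhat).
Proof.
rewrite /ga_sum !mulr_sumr ga_form_suml ga_form_sumr (reindex_inj (@invg_inj G)) /=.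
by apply: eq_big => [b|b _]; rewrite ?groupV // ga_form_Melt invgK.
Qed.

(** This is why the form takes values divisible by |B| on the lattice: one
    factor Bhat can be moved across and absorbed by the other one. *)
Lemma ga_form_eps x y :
  ga_form (x * eps) (y * eps) = #|B|%:R * ga_form (x * sgn_elt) (y * eps).
Proof.
rewrite {1}epsE mulrA ga_form_Bhat [in LHS]epsE -!mulrA Bhat2 !ga_scaleAr ga_formZr.
by rewrite -epsE.
Qed.

Variables (psi : F -> R) (psiP : nontrivial_add_char psi).

(** Disjointness of Bruhat cells leaves s = w0, and U meets the opposite Borel
    subgroup trivially, so that u = 1 is the only contribution. *)
Lemma whit_coef_pm s :
  ga_coef (whit G psi predT * flag R (pm G (w0 m))) (pm G s) = (s == w0 m)%:R.
Proof.
have lowP t u : (((u * pm G (w0 m))^-1 * pm G t)%g \in B) =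
    ((pm G t)^-1 * u * pm G (w0 m) \in B)%g.
  by rewrite -groupV invMg invgK mulgA.
rewrite /whit /wsum mulr_suml ga_coef_sum; case: eqVneq => [->|ns].
  rewrite (bigD1 1%g) //= big1 ?addr0 => [|u /andP[Uu nu1]].
    rewrite uchar1 // -scalerAl ga_coefZ mul1r elt_flag ga_coef_flag mul1g.
    by rewrite mulVg group1.
  rewrite -scalerAl ga_coefZ elt_flag ga_coef_flag lowP.
  case: (boolP (_ \in B)) => [/conj_w0P low|]; last by rewrite mulr0.
  case/eqP: nu1; apply: mx_inj; apply/matrixP => i j; rewrite mx1 mxE.
  case: (ltnP i j) => [ltij|]; last by move/uniP: Uu => Uu /Uu.
  by rewrite low // -val_eqE /= ltn_eqF.
rewrite big1 // => u Uu; rewrite -scalerAl ga_coefZ elt_flag ga_coef_flag lowP.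
case: (boolP (_ \in B)) => [/(bruhat_inj Uu) e|]; last by rewrite mulr0.
by rewrite e eqxx in ns.
Qed.

(** Divided by |B|, this value is 1: the Whittaker vector is not in the radical of
    the form modulo ell. *)
Lemma ga_form_whit_eps : ga_form (whit G psi predT * eps) eps = #|B|%:R.
Proof.
rewrite -{2}[eps]mul1r ga_formC ga_form_eps mul1r ga_formC -[RHS]mulr1; congr (_ * _).
rewrite whit_eps // ga_formZl /sgn_elt ga_form_sumr (bigD1 (w0 m)) //= big1 ?addr0.
  by rewrite ga_formZr ga_form_elt whit_coef_pm eqxx mulr1 -signr_addb addbb.
by move=> s ns; rewrite ga_formZr ga_form_elt whit_coef_pm (negPf ns) mulr0.
Qed.

Local Notation psiV := (fun a => psi (- a)).

Lemma nontrivial_psiV : nontrivial_add_char psiV.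
Proof.
case: psiP => psi0 psiD [a psia]; split; rewrite ?oppr0 //.
  by move=> b c /=; rewrite opprD psiD.
by exists (- a); rewrite opprK.
Qed.

(** The adjoint of the Whittaker element is that of the inverse character. *)
Lemma ga_form_whit x y :
  ga_form x (whit G psi predT * y) = ga_form (whit G psiV predT * x) y.
Proof.
case: (psiP) => psi0 psiD _.
rewrite /whit /wsum !mulr_suml ga_form_suml ga_form_sumr (reindex_inj (@invg_inj G)) /=.
apply: eq_big => [u|u]; rewrite groupV // => Uu.
rewrite -!scalerAl ga_formZr ga_formZl ga_form_eltM; congr (_ * _).
have e1 := ucharV psiP predT Uu.
have e2 : uchar psiV predT u * uchar psi predT u = 1.
  by rewrite /uchar -psiD addNr psi0.
have nz : uchar psi predT u != 0.
  by apply/eqP => e0; move/eqP: e2; rewrite e0 mulr0 eq_sym oner_eq0.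
by apply: (mulIf nz); rewrite e1 e2.
Qed.

End InvariantForm.

(** Up to a power of q, y eps is a multiple of the Whittaker vector; by adjunction
    the form only sees the component, along the Whittaker line of the inverse
    character, of some translate of the first argument. *)
Lemma ga_form_whit_line (F : finFieldType) (m : nat) (G : gl_group F m)
    (R : idomainType) (psi : F -> R) (z y : group_algebra R G) :
    nontrivial_add_char psi ->
  exists (k : nat) (c : R) (a : group_algebra R G),
  (#|F| ^ k)%:R * ga_form (z * eps G R) (y * eps G R) = c * #|bor G|%:R /\
  whit G (fun b => psi (- b)) predT * (a * (z * eps G R)) =
    c *: (whit G (fun b => psi (- b)) predT * eps G R).
Proof.
move=> psiP; have psiVP := nontrivial_psiV psiP.
have [k [a ea]] := whit_satM y (whit_sat_eps G psiP).
have [c ec] := whit_rank1 psiVP predT (ga_adj a * z).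
exists k, c, (ga_adj a); rewrite [ga_adj a * _]mulrA; split=> //.
rewrite -ga_formZr ea ga_form_adj (ga_form_whit psiP) [ga_adj a * _]mulrA ec ga_formZl.
by rewrite (ga_form_whit_eps _ psiVP).
Qed.

(** * The modular reduction of the lattice *)

(** Compose x |-> zeta^x with a coordinate of F as a vector space over F_p. *)
Lemma add_char_exists (F : finFieldType) (p : nat) (R : idomainType) (zeta : R) :
  p \in [pchar F] -> p.-primitive_root zeta ->
  exists psi : F -> R, nontrivial_add_char psi.
Proof.
move=> hp hzeta; have pr_p := pcharf_prime hp.
pose V : vectType 'F_p := pPrimeCharType hp.
have [i phi1] : exists i, coord (vbasis {:V}) i (1 : F) != 0.
  apply: contrapT => H; have := oner_neq0 F; case/negP; apply/eqP.
  rewrite [LHS](coord_vbasis (memvf (1 : V))) big1 // => i _.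
  case: (eqVneq (coord (vbasis {:V}) i (1 : F)) 0) => [->|ni].
    by rewrite scale0r.
  by case: H; exists i.
pose phi (x : F) : 'F_p := coord (vbasis {:V}) i (x : V).
have phiD x y : phi (x + y) = phi x + phi y by rewrite /phi -linearD.
have zp : zeta ^+ (Zp_trunc (pdiv p)).+2 = 1.
  by rewrite Fp_cast // prim_expr_order.
exists (fun x => zeta ^+ (phi x : nat)); split.
- by rewrite /phi linear0 expr0.
- by move=> x y; rewrite phiD -exprD /= expr_mod.
- exists 1; rewrite -(prim_order_dvd hzeta).
  apply: contra phi1 => dvd; rewrite -[coord _ _ _]/(phi 1); apply/eqP/val_inj => /=.
  apply/eqP; apply: contraTT dvd; rewrite -lt0n => pos.
  by rewrite gtnNdvd // -[X in (_ < X)%N](Fp_cast pr_p) ltn_ord.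
Qed.

Lemma card_coprime (F : finFieldType) (p ell : nat) :
  p \in [pchar F] -> prime ell -> ell != p -> coprime ell #|F|.
Proof.
move=> hp hell hellp; have pr_p := pcharf_prime hp.
rewrite [#|F|](card_pprimeChar hp) coprimeXr // prime_coprime //.
by rewrite dvdn_prime2.
Qed.

Lemma GLval_surj (F : finFieldType) (n : nat) (A : 'M[F]_n.-1.+1) :
  A \in unitmx -> exists g : {'GL_n[F]}, GLval g = A.
Proof. by move=> uA; exists (FinRing.unit _ uA). Qed.

Definition GLgroup (F : finFieldType) (n : nat) : gl_group F n.-1 :=
  @GLGroup F n.-1 {'GL_n[F]} (@GLval n F) (@perm_GL F n)
    (@GL_MxE n F) (@GL_1E n F) val_inj (@GL_unitmx n F) (@GLval_surj F n)
    (fun=> erefl).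

Section FinalAssembly.
Variables (F : finFieldType) (n p ell : nat) (R : idomainType).
Variables (hp : p \in [pchar F]) (hell : prime ell) (hellp : ell != p).
Variables (hR0 : [pchar R] =i pred0) (hR : local_pid R ell).
Local Notation G := {'GL_n[F]}.
Local Notation GLn := (GLgroup F n).
Local Notation RG := (group_algebra R G).
Local Notation L := (steinberg_mod F n hR).
Local Notation I := (steinberg F n R).
Local Notation eps := (steinberg_elt F n R).
Local Notation B := (borel F n).
Local Notation q := #|F|.

Lemma eps_in : eps \in @steinberg_pred F n R.
Proof. by apply/asboolP; exists 1; rewrite mul1r. Qed.

Definition eps1 : I := Steinberg eps_in.

Lemma steinberg_valE (z : I) : exists a : RG, z = a *: eps1.
Proof.
have /asboolP[a ea] := valP z.
by exists a; apply: val_inj; rewrite /= ea.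
Qed.

Lemma steinberg_valD (x y : I) :
  steinberg_val (x + y) = (steinberg_val x : RG) + steinberg_val y.
Proof. exact: (raddfD (val : I -> _)). Qed.

Lemma steinberg_valMn (x : I) k : steinberg_val (x *+ k) = (steinberg_val x : RG) *+ k.
Proof. exact: (raddfMn (val : I -> _)). Qed.

Lemma steinberg_valZ (a : RG) (x : I) :
  steinberg_val (a *: x) = a * (steinberg_val x : RG).
Proof. by []. Qed.

Definition whittaker (psi : F -> R) : RG := whit GLn psi predT.

Lemma whittaker_generates psi : nontrivial_add_char psi ->
  exists (k : nat) (a : RG), (q ^ k)%:R *: eps = a * (whittaker psi * eps).
Proof. exact: (@whit_sat_eps F n.-1 GLn R psi). Qed.

Lemma whittaker_line psi (z y : RG) : nontrivial_add_char psi ->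
  exists (k : nat) (c : R) (a : RG),
  (q ^ k)%:R * ga_form (z * eps) (y * eps) = c * #|B|%:R /\
  whittaker (fun b => psi (- b)) * (a * (z * eps)) =
    c *: (whittaker (fun b => psi (- b)) * eps).
Proof. exact: (@ga_form_whit_line F n.-1 GLn R psi z y). Qed.

Lemma form_divisible (x y : RG) : exists r, ga_form (x * eps) (y * eps) = #|B|%:R * r.
Proof. by eexists; apply: (@ga_form_eps F n.-1 GLn R x y). Qed.

Lemma form_whittaker psi : nontrivial_add_char psi ->
  ga_form (whittaker psi * eps) eps = #|B|%:R.
Proof. exact: (@ga_form_whit_eps F n.-1 GLn R psi). Qed.

Lemma card_borel_neq0 : #|B|%:R != 0 :> R.
Proof.
rewrite ((pcharf0P R).1 hR0) -lt0n.
exact: (cardG_gt0 (borel_group GLn)).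
Qed.

Lemma steinberg_filtP c (x : I) : steinberg_filt ell c x <->
  forall y : I, exists r : R,
    ga_form (steinberg_val x) (steinberg_val y) = #|B|%:R * (ell%:R ^+ c * r).
Proof.
have B0 : FracField.tofrac (#|B|%:R : R) != 0 by rewrite tofrac_eq0 card_borel_neq0.
have E (x1 y1 : R) : FracField.tofrac x1 / #|B|%:R = FracField.tofrac y1 <->
    x1 = #|B|%:R * y1.
  rewrite -[X in _ / X](rmorph_nat (@FracField.tofrac R)); split=> [e|->].
    apply/eqP; rewrite -tofrac_eq rmorphM /= -e mulrC divfK //.
  by rewrite rmorphM mulrC mulKf.
by split=> H y; have [r er] := H y; exists r; apply/E.
Qed.

Lemma bezout_ell k : exists u v : nat, (u * q ^ k)%N = (1 + v * ell)%N.
Proof.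
have co : coprime (q ^ k) ell by rewrite coprime_sym coprimeXr // (card_coprime hp).
have qk0 : (0 < q ^ k)%N by rewrite expn_gt0 (cardD1 0).
have [u v e _] := egcdnP ell qk0; exists u, v.
by rewrite e (eqP co) addnC.
Qed.

Lemma ell_div k (r c : R) : (q ^ k)%:R * r = ell%:R * c -> exists d, r = ell%:R * d.
Proof.
move=> e; have [u [v uv]] := bezout_ell k; exists (u%:R * c - v%:R * r).
have : u%:R * ((q ^ k)%:R * r) = r + v%:R * ell%:R * r.
  by rewrite mulrA -!natrM uv natrD mulrDl mul1r.
by rewrite e mulrBr [ell%:R * (u%:R * _)]mulrCA => ->;
  rewrite mulrA [ell%:R * v%:R]mulrC addrK.
Qed.

(** The ideal generated by ell and c is strictly larger than the maximal
    ideal. *)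
Lemma ell_inverse (c : R) : ~ ell_ideal R ell c -> exists d e : R, c * d = 1 + ell%:R * e.
Proof.
move=> nc; have [_ _ maxl] := lpid_maximal hR.
pose J : set R^o := [set x | exists a b : R, x = c * a + ell%:R * b].
have subJ : submodule J.
  split; first by rewrite inE; exists 0, 0; rewrite !mulr0 addr0.
  move=> a u v; rewrite !inE => -[x1 [y1 ->]] [x2 [y2 ->]].
  exists (a * x1 + x2), (a * y1 + y2).
  by rewrite -[a *: _]/(a * _) !mulrDr ![_ * (a * _)]mulrCA addrACA.
have ellJ : ell_ideal R ell `<=` J.
  by move=> x [b ->]; exists 0, b; rewrite mulr0 add0r.
case: (maxl J subJ ellJ) => [eJ|eJ].
  by case: nc; rewrite -eJ; exists 1, 0; rewrite mulr1 mulr0 addr0.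
have [a [b e]] : J 1 by rewrite eJ.
by exists a, (- b); apply/eqP; rewrite mulrN eq_sym subr_eq -e.
Qed.

Section Submodule.
Variables (M : set L) (subN : submodule M).

(** The preimage in the lattice of a submodule of its reduction. *)
Definition lifted (z : I) := M (steinberg_proj hR z).

Lemma lifted0 : lifted 0.
Proof.
have [N0 _] := subN; rewrite /lifted.
suff -> : steinberg_proj hR (0 : I) = 0 by move: N0; rewrite inE.
have := steinberg_projD hR (0 : I) 0; rewrite addr0.
by rewrite -{1}[steinberg_proj hR (0 : I)]addr0 => /addrI.
Qed.

Lemma lifted_linear (a : RG) (u v : I) : lifted u -> lifted v -> lifted (a *: u + v).
Proof.
move=> Nu Nv; have [_ /(_ (ga_reduce hR a) _ _ (mem_set Nu) (mem_set Nv))] := subN.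
by rewrite inE /lifted steinberg_projD steinberg_projZ.
Qed.

Lemma liftedZ (a : RG) (u : I) : lifted u -> lifted (a *: u).
Proof. by move=> Nu; rewrite -[_ *: _]addr0; apply: lifted_linear => //; apply: lifted0. Qed.

Lemma lifted_congr (u v w : I) : u - v = w *+ ell -> lifted v -> lifted u.
Proof.
by move=> e; rewrite /lifted; have -> : steinberg_proj hR u = steinberg_proj hR v
  by apply/steinberg_projP; exists w.
Qed.

(** A power of q times eps lies in the preimage, and q is invertible modulo
    ell. *)
Lemma lifted_whittaker psi : nontrivial_add_char psi ->
  lifted (whittaker psi *: eps1) -> M = setT.
Proof.
move=> psiP Nw; have [k [a ea]] := whittaker_generates psiP.
have Nq : lifted (eps1 *+ q ^ k).
  have -> : eps1 *+ q ^ k = a *: (whittaker psi *: eps1).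
    apply: val_inj; rewrite raddfMn /= -[RHS]/(a * (whittaker psi * eps)) -ea.
    by rewrite scaler_nat.
  exact: liftedZ.
have [u [v uv]] := bezout_ell k.
have N1 : lifted eps1.
  have : lifted ((u%:R : RG) *: (eps1 *+ q ^ k)) by apply: liftedZ.
  apply: (@lifted_congr _ _ (- (eps1 *+ v))).
  by rewrite scaler_nat -mulrnA mulnC uv mulrnDr mulr1n mulNrn -mulrnA opprD addNKr.
apply/seteqP; split=> // x _; rewrite -(steinberg_proj_repr x).
have [b ->] := steinberg_valE
  (generic_quotient.repr (x : Quotient.quot (@ell_steinberg F n R ell))).
exact: (liftedZ b N1).
Qed.

(** If the form took on z a value not divisible by ell, [whittaker_line] would
    produce in M a Whittaker vector with a coefficient invertible modulo ell,
    hence the Whittaker vector itself, and M would be everything. *)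
Lemma proper_submodule_filt (psi : F -> R) : nontrivial_add_char psi ->
  M <> setT -> M `<=` steinberg_mod_filt F n hR 1.
Proof.
move=> psiP nT x Nx;
  pose z : I := generic_quotient.repr (x : Quotient.quot (@ell_steinberg F n R ell)).
have zx : steinberg_proj hR z = x by apply: steinberg_proj_repr.
have Nz : lifted z by rewrite /lifted zx.
exists z => //; exists z, 0; split; last by rewrite mul0rn addr0.
apply/steinberg_filtP => y.
have [z0 ez] := steinberg_valE z; have [b ey] := steinberg_valE y.
have vz : steinberg_val z = z0 * eps by rewrite ez.
have vy : steinberg_val y = b * eps by rewrite ey.
rewrite vz vy; have [r er] := form_divisible z0 b; rewrite er.
have [k [c [a [ec eline]]]] := whittaker_line z0 b psiP.
set W := whittaker _ in eline.
have qr : (q ^ k)%:R * r = c.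
  apply: (mulfI card_borel_neq0); rewrite mulrCA -er [RHS]mulrC -ec //.
have [[c' cE]|/ell_inverse[d [e cd]]] := pselect (ell_ideal R ell c).
  have [d ->] := @ell_div k r c' (etrans qr cE).
  by exists d; rewrite expr1.
case: nT; apply: (lifted_whittaker (nontrivial_psiV psiP)).
have : lifted ((d%:A * (W * a)) *: z) by apply: liftedZ.
apply: (@lifted_congr _ _ (- (e%:A *: (W *: eps1)))).
apply: val_inj; rewrite raddfB raddfMn raddfN /=.
have regE (a1 b1 : RG) : a1 *: (b1 : RG^o) = a1 * b1 by [].
rewrite -/W !regE vz -!mulrA eline.
rewrite -!scalerAl !mul1r scalerA [d * c]mulrC cd scalerDl scale1r opprD addNKr.
by rewrite mulr_natl -scalerMnl mulNrn.
Qed.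

End Submodule.

Lemma filt_submodule c : submodule (steinberg_mod_filt F n hR c).
Proof.
split.
  rewrite inE; exists (0 : I); last first.
    have := steinberg_projD hR (0 : I) 0; rewrite addr0.
    by rewrite -{1}[steinberg_proj hR (0 : I)]addr0 => /addrI.
  exists 0, 0; split; last by rewrite mul0rn addr0.
  apply/steinberg_filtP => y; exists 0.
  by rewrite !mulr0 [LHS]ga_form0l.
move=> a u v; rewrite !inE => -[_ [xu [yu [fu ->]]] <-] [_ [xv [yv [fv ->]]] <-].
exists (ga_lift a *: (xu + yu *+ ell) + (xv + yv *+ ell)); last first.
  rewrite (steinberg_projD hR (ga_lift a *: (xu + yu *+ ell))).
  by rewrite (steinberg_projZ hR (ga_lift a)) ga_liftK.
exists (ga_lift a *: xu + xv), (ga_lift a *: yu + yv); split; last first.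
  by rewrite scalerDr mulrnDl scalerMnr addrACA.
move/steinberg_filtP: fu => fu; move/steinberg_filtP: fv => fv.
apply/steinberg_filtP => y.
have [r1 e1] := fu (ga_adj (ga_lift a) *: y); have [r2 e2] := fv y.
exists (r1 + r2); rewrite steinberg_valD ga_formDl e2 !mulrDr; congr (_ + _).
by rewrite -e1 !steinberg_valZ ga_formC ga_form_adj ga_formC.
Qed.

(** The Whittaker vector and eps have product 1 for the normalized form, while ell
    would divide this product if the Whittaker vector were in the submodule. *)
Lemma filt_proper (psi : F -> R) :
  nontrivial_add_char psi -> steinberg_mod_filt F n hR 1 <> setT.
Proof.
move=> psiP eT.
have : steinberg_mod_filt F n hR 1 (steinberg_proj hR (whittaker psi *: eps1)) by rewrite eT.
case=> _ [x [y [fx ->]]] /steinberg_projP[z ez].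
move/steinberg_filtP: fx => /(_ eps1)[r er].
have [w ew] : exists w : I, whittaker psi *: eps1 = x + w *+ ell.
  exists (y - z); rewrite mulrnBl -ez opprB.
  by rewrite addrA addrC subrK.
have := form_whittaker psiP.
have -> : whittaker psi * eps = steinberg_val x + steinberg_val w *+ ell.
  by rewrite -steinberg_valMn -steinberg_valD -ew.
rewrite ga_formDl er expr1 -(@scaler_nat R) ga_formZl.
have [a ea] := steinberg_valE w.
have -> : steinberg_val w = a * eps by rewrite ea.
have [s] := form_divisible a 1; rewrite mul1r => ->.
rewrite mulrCA -mulrDr -mulrDr mulrCA -[RHS]mulr1 => /(mulfI card_borel_neq0) e1.
have [_ nT _] := lpid_maximal hR; apply: nT; apply/seteqP; split=> // t _.
by exists ((r + s) * t); rewrite mulrA e1 mul1r.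
Qed.

End FinalAssembly.

Theorem theorem4p11 (F : finFieldType) (n p ell : nat) (R : idomainType)
    (zeta : R) (hn : (2 <= n)%N) (hp : p \in [pchar F])
    (hell : prime ell) (hellp : ell != p)
    (hR0 : [pchar R] =i pred0) (hR : local_pid R ell)
    (hzeta : p.-primitive_root zeta) :
  (forall N : set (steinberg_mod F n hR),
     submodule N -> N <> setT -> N `<=` steinberg_mod_filt F n hR 1)
  /\ radical (steinberg_mod F n hR) = steinberg_mod_filt F n hR 1.
Proof.
have [psi psiP] := add_char_exists hp hzeta.
have sub1 N : submodule N -> N <> setT -> N `<=` steinberg_mod_filt F n hR 1.
  by move=> subN NT; exact: (proper_submodule_filt hp hell hellp hR0 subN psiP NT).
have nT := filt_proper hR0 (hR := hR) psiP (n := n).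
have subL := @filt_submodule F n ell R hR0 hR 1.
split=> //; apply/seteqP; split=> x.
  apply; split=> // N' subN' leN'.
  have [->|N'T] := pselect (N' = setT); first by right.
  by left; apply/seteqP; split=> //; apply: sub1.
move=> Lx N [subN NT maxN].
by case: (maxN _ subL (sub1 N subN NT)) => [<-|/nT].
Qed.
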